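(* Let $X$ and $Y$ be infinite dimensional complex Banach spaces. An additive surjective map $\varphi:\mathcal{B}(X)\to\mathcal{B}(Y)$ satisfies $\gamma(\varphi(T))=\gamma(T)$ for all $T\in\mathcal{B}(X)$ if and only if one of the following holds: (1) there are bijective isometries $U:X\to Y$ and $V:Y\to X$, both linear or both conjugate linear, such that $\varphi(T)=UTV$ for all $T\in\mathcal{B}(X)$; or (2) there are bijective isometries $U:X^*\to Y$ and $V:Y\to X^*$, both linear or both conjugate linear, such that $\varphi(T)=UT^*V$ for all $T\in\mathcal{B}(X)$. Moreover, case (2) cannot occur if any one of $X$ and $Y$ is not reflexive.
   Context: For a complex Banach space $Z$, $\mathcal{B}(Z)$ denotes the algebra of all bounded linear operators on $Z$ and $Z^*$ its (topological) dual space. A map $\varphi$ is additive if $\varphi(S+T)=\varphi(S)+\varphi(T)$ for all $S,T$ (no homogeneity is assumed). For $T\in\mathcal{B}(X)$, $T^*\in\mathcal{B}(X^* )$ is the Banach space adjoint of $T$. A map $U$ between complex vector spaces is conjugate linear if it is additive and $U(\lambda x)=\overline{\lambda}Ux$ for all scalars $\lambda$ and vectors $x$. The reduced minimum modulus of $T\in\mathcal{B}(Z)$ is $$\gamma(T):=\begin{cases}\inf\{\|Tz\|:\ z\in Z,\ \mathrm{dist}(z,\ker T)\geq 1\}&\text{if }T\neq 0,\\ \infty&\text{if }T=0.\end{cases}$$ *)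

(* Defs.v *)
From HB Require Import structures.
From mathcomp Require Import all_boot all_order all_algebra.
From mathcomp Require Import complex.
From mathcomp Require Import boolp classical_sets functions reals ereal topology.
From mathcomp Require Import normedtype.

Set Implicit Arguments.
Unset Strict Implicit.
Unset Printing Implicit Defensive.

Import Order.TTheory GRing.Theory Num.Theory.
Import numFieldNormedType.Exports.

Local Open Scope classical_set_scope.
Local Open Scope complex_scope.
Local Open Scope ring_scope.

(* Importing ssrnum makes Re the R[i]-valued real part; here Re is R-valued. *)
Local Notation Re := complex.Re.

(* A normed module over R[i] has its norm in R[i]; rnorm is the same number
   in R (see rnormE). *)
Definition rnorm (R : realType) (V : normedModType R[i]) (x : V) : R :=
  Re `|x|.

Section RealNorm.
Context (R : realType) (V : normedModType R[i]).
Implicit Types x y : V.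

Lemma rnormE x : (rnorm x)%:C = `|x|.
Proof. by apply: RRe_real; exact: normr_real. Qed.

Lemma rnorm_ge0 x : 0 <= rnorm x.
Proof. by rewrite -lecR rnormE normr_ge0. Qed.

Lemma rnorm0 : rnorm (0 : V) = 0.
Proof. by rewrite /rnorm normr0. Qed.

Lemma rnorm_eq0 x : rnorm x = 0 -> x = 0.
Proof. by move=> x0; apply: normr0_eq0; rewrite -rnormE x0. Qed.

Lemma rnormD x y : rnorm (x + y) <= rnorm x + rnorm y.
Proof. by rewrite -lecR rmorphD /= !rnormE ler_normD. Qed.

Lemma rnormZ (a : R[i]) x : rnorm (a *: x) = Re `|a| * rnorm x.
Proof.
apply/(@complexI R); rewrite rmorphM rnormE normrZ.
by congr (_ * _); exact/esym/rnormE.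
Qed.

End RealNorm.

Section BoundedOperators.
Context (R : realType) (X Y : normedModType R[i]).

Definition is_bounded_linear (f : X -> Y) : Prop :=
  linear f /\ exists M : R, forall x, rnorm (f x) <= M * rnorm x.

Definition bounded_linear_pred : {pred X -> Y} :=
  fun f => `[< is_bounded_linear f >].

Lemma bounded_linear_submod : submod_closed bounded_linear_pred.
Proof.
split=> [|a f g /asboolP[lf [M Mf]] /asboolP[lg [N Ng]]]; apply/asboolP; split.
- by move=> a x y /=; rewrite scaler0 addr0.
- by exists 0 => x; rewrite mul0r rnorm0.
- move=> b x y; rewrite !fctE lf lg !scalerDr !scalerA mulrC.
  by rewrite addrACA.
exists (Re `|a| * M + N) => x; rewrite !fctE (le_trans (rnormD _ _))//.
rewrite mulrDl lerD// rnormZ -mulrA ler_wpM2l//.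
exact: (@rnorm_ge0 R R[i]^o).
Qed.

HB.instance Definition _ :=
  GRing.isSubmodClosed.Build R[i] (X -> Y) bounded_linear_pred
    bounded_linear_submod.

(* bop X X is the algebra B(X); its norm, declared below, is opnorm. *)
Record bop := Bop {
  bop_fun :> X -> Y;
  bop_subproof : bop_fun \in bounded_linear_pred
}.

HB.instance Definition _ := [isSub for bop_fun].
HB.instance Definition _ := [Choice of bop by <:].
HB.instance Definition _ := [SubChoice_isSubLmodule of bop by <:].

Definition mkbop (f : X -> Y) (bf : is_bounded_linear f) : bop :=
  Bop (asboolT bf).

Lemma bopP (f : bop) : is_bounded_linear f.
Proof. exact: asboolW (bop_subproof f). Qed.

HB.instance Definition _ (f : bop) :=
  GRing.isLinear.Build R[i] X Y _ (bop_fun f) (proj1 (bopP f)).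

Lemma bop_ext (f g : bop) : (forall x, f x = g x) -> f = g.
Proof. by move=> fg; apply: val_inj; apply/funext. Qed.

Lemma bop0E x : (0 : bop) x = 0.
Proof. by []. Qed.

Lemma bopDE (f g : bop) x : (f + g) x = f x + g x.
Proof. by []. Qed.

Lemma bopZE a (f : bop) x : (a *: f) x = a *: f x.
Proof. by []. Qed.

Definition opnorm (f : bop) : R :=
  sup [set rnorm (f x) | x in [set x | rnorm x <= 1]].

Let opnorm_has_sup (f : bop) :
  has_sup [set rnorm (f x) | x in [set x | rnorm x <= 1]].
Proof.
split; first by exists (rnorm (f 0)), 0 => //=; rewrite rnorm0.
have [_ [M Mf]] := bopP f; exists `|M| => _ [x /= x1 <-].
rewrite (le_trans (Mf x))// (le_trans (ler_norm _))// normrM.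
by rewrite ler_piMr// ger0_norm// rnorm_ge0.
Qed.

Lemma opnorm_ub (f : bop) x : rnorm x <= 1 -> rnorm (f x) <= opnorm f.
Proof. by move=> x1; apply: sup_upper_bound => //; exists x. Qed.

Lemma opnorm_lub (f : bop) (M : R) :
  (forall x, rnorm x <= 1 -> rnorm (f x) <= M) -> opnorm f <= M.
Proof.
move=> fM; apply: ge_sup; first by have [] := opnorm_has_sup f.
by move=> _ [x /= x1 <-]; exact: fM.
Qed.

Lemma opnorm_ge0 (f : bop) : 0 <= opnorm f.
Proof.
by apply: le_trans (rnorm_ge0 (f 0)) (opnorm_ub _ _); rewrite rnorm0.
Qed.

Lemma opnorm_le (f : bop) x : rnorm (f x) <= opnorm f * rnorm x.
Proof.
have [->|x0] := eqVneq x 0; first by rewrite linear0 !rnorm0 mulr0.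
have nx : 0 < rnorm x.
  rewrite lt_neqAle rnorm_ge0 andbT eq_sym.
  by apply: contra_neq x0; exact: rnorm_eq0.
have nE : Re `|(rnorm x)^-1%:C| = (rnorm x)^-1 :> R.
  by rewrite ger0_norm// lecR invr_ge0 ltW.
have := @opnorm_ub f ((rnorm x)^-1%:C *: x).
rewrite linearZ /= !rnormZ nE mulVf ?gt_eqF// => /(_ (lexx _)).
by rewrite mulrC ler_pdivrMr.
Qed.

Lemma opnormD (f g : bop) : opnorm (f + g) <= opnorm f + opnorm g.
Proof.
apply: opnorm_lub => x x1; rewrite bopDE (le_trans (rnormD _ _))//.
by rewrite lerD// opnorm_ub.
Qed.

Let opnormZ_le (a : R[i]) (f : bop) : opnorm (a *: f) <= Re `|a| * opnorm f.
Proof.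
apply: opnorm_lub => x x1; rewrite bopZE rnormZ ler_wpM2l ?opnorm_ub//.
exact: (@rnorm_ge0 R R[i]^o).
Qed.

Lemma opnormZ (a : R[i]) (f : bop) : opnorm (a *: f) = Re `|a| * opnorm f.
Proof.
apply/eqP; rewrite eq_le opnormZ_le andTb.
have [->|a0] := eqVneq a 0; first by rewrite normr0 mul0r opnorm_ge0.
have na : 0 < Re `|a| by rewrite -ltcR RRe_real ?normr_real// normr_gt0.
rewrite mulrC -ler_pdivlMr//.
have := opnormZ_le a^-1 (a *: f); rewrite scalerA mulVf// scale1r.
suff -> : Re `|a^-1| = (Re `|a|)^-1 by rewrite mulrC.
apply/(@complexI R); rewrite fmorphV normfV.
have aE : (Re `|a|)%:C = `|a| by exact: RRe_real.
by rewrite -[X in _ = X^-1]/((Re `|a|)%:C) aE RRe_real// -aE -fmorphV.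
Qed.

Lemma opnorm_eq0 (f : bop) : opnorm f = 0 -> f = 0.
Proof.
move=> f0; apply: bop_ext => x; apply: rnorm_eq0; apply/eqP.
by rewrite eq_le rnorm_ge0 andbT (le_trans (opnorm_le f x))// f0 mul0r.
Qed.

Let bnorm (f : bop) : R[i] := (opnorm f)%:C.

Let bnormD f g : bnorm (f + g) <= bnorm f + bnorm g.
Proof. by rewrite /bnorm -rmorphD /= lecR opnormD. Qed.

Let bnormZ (a : R[i]) f : bnorm (a *: f) = `|a| * bnorm f.
Proof.
by rewrite /bnorm opnormZ rmorphM; congr (_ * _); exact: RRe_real.
Qed.

Let bnorm_eq0 f : bnorm f = 0 -> f = 0.
Proof. by move/(congr1 (@Re R)) => /= /opnorm_eq0. Qed.

HB.instance Definition _ :=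
  Lmodule_isNormed.Build R[i] bop bnormD bnormZ bnorm_eq0.

Lemma bop_normE (f : bop) : `|f| = (opnorm f)%:C.
Proof. by []. Qed.

Lemma rnorm_bopE (f : bop) : rnorm f = opnorm f.
Proof. by []. Qed.

End BoundedOperators.

Definition dual (R : realType) (X : normedModType R[i]) : normedModType R[i] :=
  bop X R[i]^o.

Section Adjoint.
Context (R : realType).
Implicit Types X Y Z : normedModType R[i].

Lemma bop_comp_subproof X Y Z (S : bop Y Z) (T : bop X Y) :
  is_bounded_linear (S \o T).
Proof.
split=> [a x y|]; first by rewrite /= !linearP.
exists (opnorm S * opnorm T) => x /=; rewrite (le_trans (opnorm_le _ _))//.
by rewrite -mulrA ler_wpM2l ?opnorm_ge0 ?opnorm_le.
Qed.

Definition bop_comp X Y Z (S : bop Y Z) (T : bop X Y) : bop X Z :=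
  mkbop (bop_comp_subproof S T).

Lemma adjoint_subproof X Y (T : bop X Y) :
  is_bounded_linear (fun f : dual Y => bop_comp f T : dual X).
Proof.
split=> [a f g|]; first exact: bop_ext.
exists (opnorm T) => f; apply: opnorm_lub => x x1.
rewrite (le_trans (opnorm_le f (T x)))// mulrC ler_wpM2r ?opnorm_ge0//.
exact: opnorm_ub.
Qed.

Definition adjoint X Y (T : bop X Y) : bop (dual Y) (dual X) :=
  mkbop (adjoint_subproof T).

Lemma adjointE X Y (T : bop X Y) (f : dual Y) x : adjoint T f x = f (T x).
Proof. by []. Qed.

End Adjoint.

Section Bidual.
Context (R : realType) (X : normedModType R[i]).

Lemma bidual_embed_subproof (x : X) :
  is_bounded_linear (fun f : dual X => f x : R[i]^o).
Proof.
split=> [a f g //|]; exists (rnorm x) => f.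
by rewrite mulrC; exact: (opnorm_le f).
Qed.

Definition bidual_embed (x : X) : dual (dual X) :=
  mkbop (bidual_embed_subproof x).

Lemma bidual_embedE (x : X) (f : dual X) : bidual_embed x f = f x.
Proof. by []. Qed.

Definition reflexive_space : Prop :=
  forall F : dual (dual X), exists x : X, bidual_embed x = F.

End Bidual.

Definition infinite_dimensional (R : realType) (X : normedModType R[i])
    : Prop :=
  forall (n : nat) (e : 'I_n -> X),
    ~ (forall x : X, exists c : 'I_n -> R[i], x = \sum_(k < n) c k *: e k).

Definition conjugate_linear (R : realType) (X Y : normedModType R[i])
    (U : X -> Y) : Prop :=
  {morph U : x y / x + y} /\ forall (a : R[i]) x, U (a *: x) = a^*%C *: U x.

Definition isometry (R : realType) (X Y : normedModType R[i])
    (U : X -> Y) : Prop :=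
  forall x y, `|U x - U y| = `|x - y|.

Definition bijective_isometry (R : realType) (X Y : normedModType R[i])
    (U : X -> Y) : Prop :=
  bijective U /\ isometry U.

Definition dist_to (R : realType) (X : normedModType R[i]) (A : set X) (z : X)
    : R :=
  inf [set rnorm (z - w) | w in A].

Definition kernel (R : realType) (X Y : normedModType R[i]) (T : bop X Y)
    : set X :=
  [set z | T z = 0].

Definition red_min_modulus (R : realType) (X Y : normedModType R[i])
    (T : bop X Y) : \bar R :=
  if T == 0 then +oo%E
  else ereal_inf
    [set (rnorm (T z))%:E | z in [set z | 1 <= dist_to (kernel T) z]].

Section StandardForms.
Context (R : realType) (X Y : normedModType R[i]).
Variable phi : bop X X -> bop Y Y.

Definition direct_form : Prop :=
  exists (U : X -> Y) (V : Y -> X),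
    [/\ bijective_isometry U, bijective_isometry V,
        (linear U /\ linear V) \/ (conjugate_linear U /\ conjugate_linear V)
      & forall T y, phi T y = U (T (V y))].

Definition adjoint_form : Prop :=
  exists (U : dual X -> Y) (V : Y -> dual X),
    [/\ bijective_isometry U, bijective_isometry V,
        (linear U /\ linear V) \/ (conjugate_linear U /\ conjugate_linear V)
      & forall T y, phi T y = U (adjoint T (V y))].

End StandardForms.

(* Main.v *)
Require Import Defs.
From HB Require Import structures.
From mathcomp Require Import all_boot all_order all_algebra.
From mathcomp Require Import complex ring lra.
From mathcomp Require Import boolp classical_sets functions reals ereal topology.
From mathcomp Require Import normedtype.

Set Implicit Arguments.
Unset Strict Implicit.
Unset Printing Implicit Defensive.

Import Order.TTheory GRing.Theory Num.Theory.
Import numFieldNormedType.Exports.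

Local Open Scope complex_scope.
Local Open Scope ring_scope.

Local Notation Re := complex.Re.
Local Notation Im := complex.Im.

(** The standard forms preserve the reduced minimum modulus, written gamma
    below, because bijective isometries transport kernels and distances
    ([gamma_conjugate]). For the form with adjoints one also needs that gamma
    takes the same value at [T] and [T^*]. A Hahn-Banach extension from the
    range of [T] gives one inequality ([gamma_adjoint_ge]); the other follows
    since surjectivity of the map makes every operator on the dual of [X] an
    adjoint, so that [X] is reflexive and [T] can be identified with [T^**].

    Conversely, let the additive surjective map [phi] preserve gamma. Since
    only [0] has infinite gamma, [phi] is bijective. Call an operator
    semi-invertible if it is bounded below or open onto its codomain. Such
    operators are exactly those whose gamma stays away from [0] under all
    perturbations [S / n] with [n] large ([perturbation_stableP]). Additive maps
    respect division by integers, so [phi] preserves semi-invertibility in both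
    directions, although nothing is known about its continuity.

    A rank one perturbation [T + rank1 x f] of a semi-invertible [T] fails to be
    semi-invertible exactly if [f] is [-1] at a preimage of [x] under [T] and
    vanishes on the kernel of [T] ([rank1_perturb_bad], [rank1_perturb_badP]).
    Hence, for semi-invertible [T], [T + A] and [T + 2 A] cannot both fail if [A]
    has rank at most one, while for every other [A] some [T] makes both fail
    ([semi_alternative_rank_le1]). So [phi] preserves rank one operators in both
    directions, and it preserves their norms, as gamma of a rank one operator is
    its norm ([rank1_gamma]).

    An additive bijection preserving elementary tensors in both directions is a
    tensor product of two additive maps, up to exchanging the factors
    ([elementary_preserver]). The two additive maps are homogeneous up to a
    common map [tau] of the scalars, and after rescaling they are isometric,
    which forces [tau] to be the identity or the conjugation
    ([normalize_factors]). This gives [phi (rank1 x f) = rank1 (U x) (W f)] or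
    [phi (rank1 x f) = rank1 (U f) (W x)] with [U] and [W] semilinear surjective
    isometries. Finally, for invertible [T] the set of bad rank one perturbations
    records all values [f (T^-1 x)]; comparing it with the corresponding set for
    [phi T] yields [phi T = U T V], respectively [phi T = U T^* V], where [V] is
    [U^-1] composed with [phi] of the identity ([reconstruction]). Every operator
    is a difference of two invertible ones, so the formula holds throughout. *)

(** * The modulus and the norm as real numbers *)

Section Modulus.
Context (R : realType).
Implicit Types (a b z : R[i]) (r : R).

Definition cabs z : R := rnorm (z : R[i]^o).

Lemma cabsE z : (cabs z)%:C = `|z|.
Proof. exact: rnormE. Qed.

Lemma cabs_ge0 z : 0 <= cabs z.
Proof. exact: rnorm_ge0. Qed.

Lemma cabs0 : cabs 0 = 0.
Proof. exact: rnorm0. Qed.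

Lemma cabsM a b : cabs (a * b) = cabs a * cabs b.
Proof. exact: (@rnormZ R R[i]^o a b). Qed.

Lemma cabs_eq0 z : cabs z = 0 -> z = 0.
Proof. exact: (@rnorm_eq0 R R[i]^o z). Qed.

Lemma cabs_gt0 z : z != 0 -> 0 < cabs z.
Proof.
move=> z0; rewrite lt_neqAle cabs_ge0 andbT eq_sym.
by apply: contra_neq z0; exact: cabs_eq0.
Qed.

Lemma cabs_sqr z : cabs z ^+ 2 = Re z ^+ 2 + Im z ^+ 2.
Proof. by apply: complexI; rewrite add_Re2_Im2 -cabsE rmorphXn. Qed.

Lemma cabs_real r : cabs r%:C = `|r|.
Proof.
apply/eqP; rewrite -(eqrXn2 (n:=2))// ?cabs_ge0// ?normr_ge0// cabs_sqr /= expr0n /= addr0.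
by rewrite real_normK ?num_real.
Qed.

Lemma cabs_pos r : 0 <= r -> cabs r%:C = r.
Proof. by move=> r0; rewrite cabs_real ger0_norm. Qed.

Lemma cabs1 : cabs 1 = 1.
Proof. by rewrite -[1](rmorph1 (real_complex R)) cabs_pos. Qed.

Lemma cabs_conj z : cabs z^*%C = cabs z.
Proof.
by apply/eqP; rewrite -(eqrXn2 (n:=2))// ?cabs_ge0// !cabs_sqr; case: z => x y /=; rewrite sqrrN.
Qed.

Lemma Re_le_cabs z : Re z <= cabs z.
Proof.
apply: le_trans (ler_norm _) _; rewrite -ler_sqr ?nnegrE ?cabs_ge0//.
by rewrite cabs_sqr real_normK ?num_real// lerDl sqr_ge0.
Qed.

Lemma cabsV z : cabs z^-1 = (cabs z)^-1.
Proof.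
have [->|z0] := eqVneq z 0; first by rewrite invr0 cabs0 invr0.
apply: (mulfI (lt0r_neq0 (cabs_gt0 z0))).
by rewrite -cabsM !mulfV ?cabs1// lt0r_neq0 ?cabs_gt0.
Qed.

End Modulus.

Section Norm.
Context (R : realType) (V : normedModType R[i]).
Implicit Types (x y : V) (a : R[i]).

Lemma rnZ a x : rnorm (a *: x) = cabs a * rnorm x.
Proof. exact: rnormZ. Qed.

Lemma rnZr (r : R) x : 0 <= r -> rnorm (r%:C *: x) = r * rnorm x.
Proof. by move=> r0; rewrite rnZ cabs_pos. Qed.

Lemma rnN x : rnorm (- x) = rnorm x.
Proof. by rewrite /rnorm normrN. Qed.

Lemma rnB x y : rnorm (x - y) <= rnorm x + rnorm y.
Proof. by rewrite -[rnorm y]rnN rnormD. Qed.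

Lemma rnB_sym x y : rnorm (x - y) = rnorm (y - x).
Proof. by rewrite -rnN opprB. Qed.

Lemma rnD_ge x y : rnorm x - rnorm y <= rnorm (x + y).
Proof. by rewrite lerBlDr -[X in rnorm X <= _](addrK y) rnB. Qed.

Lemma rn_gt0 x : x != 0 -> 0 < rnorm x.
Proof.
move=> x0; rewrite lt_neqAle rnorm_ge0 andbT eq_sym.
by apply: contra_neq x0; exact: rnorm_eq0.
Qed.

End Norm.

Section OperatorRules.
Context (R : realType) (X Y : normedModType R[i]).
Implicit Types (S T : bop X Y) (x y : X).

Lemma bop_add T x y : T (x + y) = T x + T y.
Proof. exact: (linearD T). Qed.

Lemma bop_zero T : T 0 = 0.
Proof. exact: (linear0 T). Qed.

Lemma bop_opp T x : T (- x) = - T x.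
Proof. exact: (linearN T). Qed.

Lemma bop_sub T x y : T (x - y) = T x - T y.
Proof. by rewrite bop_add bop_opp. Qed.

Lemma bop_scale T a x : T (a *: x) = a *: T x.
Proof. by have [l _] := bopP T; have := l a x 0; rewrite !addr0 bop_zero addr0. Qed.

Lemma bop_le T x : rnorm (T x) <= rnorm T * rnorm x.
Proof. exact: opnorm_le. Qed.

End OperatorRules.

(** * The Hahn-Banach theorem *)

Section HahnBanach.
Context (R : realType) (V : normedModType R[i]).
Implicit Types (G : set (V * R)) (v : V) (r s t : R).

Section RealCase.
Context (p : V -> R).
Hypothesis p_subadd : forall v w, p (v + w) <= p v + p w.
Hypothesis p_pos_homog : forall t v, 0 <= t -> p (t%:C *: v) = t * p v.

Let dominated G := [/\ G (0, 0),
  forall u w, G u -> G w -> G (u.1 + w.1, u.2 + w.2),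
  forall t u, G u -> G (t%:C *: u.1, t * u.2) &
  forall u, G u -> u.2 <= p u.1].

(** One step of the extension: the new value at [v] may be any number between
    [sup (r - p (w - v))] and [inf (p (w + v) - r)], where [(w, r)] runs
    through the graph, and subadditivity of [p] orders these two bounds. *)
Lemma dominated_extend G v : dominated G ->
  exists2 G', dominated G' & (G `<=` G')%classic /\ exists c, G' (v, c).
Proof.
move=> [G0 GD GZ Gp].
pose E := [set u.2 - p (u.1 - v) | u in G]%classic.
have Eub u : G u -> ubound E (p (u.1 + v) - u.2).
  move=> Gu _ [w Gw <-]; rewrite lerBlDr addrAC lerBrDr.
  apply: le_trans (Gp _ (GD _ _ Gw Gu)) _ => /=.
  have := p_subadd (w.1 - v) (u.1 + v).
  by rewrite addrACA [- v + v]addrC subrr addr0 [p (u.1 + v) + _]addrC.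
have Esup : has_sup E.
  split; first by exists (0 - p (0 - v)), (0, 0).
  by eexists; exact: (Eub _ G0).
pose c := sup E.
have lec u : G u -> u.2 - p (u.1 - v) <= c.
  by move=> Gu; apply: ub_le_sup; [case: Esup|exists u].
have cle u : G u -> c <= p (u.1 + v) - u.2.
  by move=> Gu; apply: ge_sup; [case: Esup|exact: Eub].
pose G' := [set z | exists2 u, G u & exists t, z = (u.1 + t%:C *: v, u.2 + t * c)]%classic.
exists G'; last first.
  split; last first.
    by exists c, (0, 0) => //; exists 1; rewrite /= !add0r scale1r mul1r.
  move=> u Gu; exists u => //; exists 0.
  by rewrite scale0r mul0r !addr0; case: u {Gu}.
split.
- by exists (0, 0) => //; exists 0; rewrite /= scale0r mul0r !addr0.
- move=> _ _ [u Gu [t ->]] [w Gw [s ->]] /=; exists (u.1 + w.1, u.2 + w.2); first exact: GD.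
  by exists (t + s); rewrite /= rmorphD scalerDl mulrDl /= addrACA; congr pair; rewrite addrACA.
- move=> s _ [u Gu [t ->]] /=; exists (s%:C *: u.1, s * u.2); first exact: GZ.
  by exists (s * t); rewrite /= rmorphM scalerDr scalerA mulrDr mulrA.
move=> _ [u Gu [t ->]] /=.
have [t0|t0|->] := ltgtP t 0; last by rewrite scale0r mul0r !addr0; exact: Gp.
- have nt : 0 < - t by rewrite oppr_gt0.
  have := lec _ (GZ ((- t)^-1) _ Gu) => /=; rewrite -(ler_pM2l nt) mulrBr.
  rewrite mulrA mulfV ?gt_eqF// mul1r -(p_pos_homog _ (ltW nt)) scalerBr scalerA -rmorphM.
  rewrite mulfV ?gt_eqF// rmorph1 scale1r rmorphN scaleNr opprK mulNr => H.
  lra.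
have := cle _ (GZ t^-1 _ Gu) => /=; rewrite -(ler_pM2l t0) mulrBr.
rewrite mulrA mulfV ?gt_eqF// mul1r -(p_pos_homog _ (ltW t0)) scalerDr scalerA -rmorphM.
by rewrite mulfV ?gt_eqF// rmorph1 scale1r => H; lra.
Qed.

Lemma dominated_total G0 : dominated G0 ->
  exists2 G, dominated G & (G0 `<=` G)%classic /\ forall v, exists c, G (v, c).
Proof.
move=> dG0.
pose P := [set A | dominated (G0 `|` A)]%classic.
have [F FP Ftot|A [PA Amax]] := @Zorn_bigcup (V * R)%type P.
  (* any two points of the union lie in a single member of the chain *)
  have pick2 u w : (G0 `|` \bigcup_(X in F) X)%classic u ->
      (G0 `|` \bigcup_(X in F) X)%classic w ->
      exists B, [/\ dominated (G0 `|` B)%classic, (G0 `|` B)%classic u, (G0 `|` B)%classic w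
        & (B `<=` \bigcup_(X in F) X)%classic].
    have sub B : F B -> (B `<=` \bigcup_(X in F) X)%classic by move=> FB x Bx; exists B.
    move=> [Gu|[B FB Bu]] [Gw|[C FC Cw]].
    - by exists set0; rewrite setU0; split.
    - by exists C; split; [exact: FP|left|right|exact: sub].
    - by exists B; split; [exact: FP|right|left|exact: sub].
    - have [BC|CB] := Ftot _ _ FB FC.
        by exists C; split; [exact: FP|right; exact: BC|right|exact: sub].
      by exists B; split; [exact: FP|right|right; exact: CB|exact: sub].
  have incl B : (B `<=` \bigcup_(X in F) X)%classic ->
      (G0 `|` B `<=` G0 `|` \bigcup_(X in F) X)%classic.
    by move=> sB x [Gx|Bx]; [left|right; exact: sB].
  split.
  - by left; case: dG0.
  - by move=> u w /pick2 h /h [B [[_ BD _ _] Bu Bw /incl]]; apply; exact: BD.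
  - by move=> t u Gu; have [B [[_ _ BZ _] Bu _ /incl]] := pick2 u u Gu Gu; apply; exact: BZ.
  - by move=> u Gu; have [B [[_ _ _ Bp] Bu _ _]] := pick2 u u Gu Gu; exact: Bp.
exists (G0 `|` A)%classic => //; split; first by move=> u; left.
move=> v; have [G' dG' [sG' [c G'c]]] := dominated_extend v PA.
exists c; apply: contrapT => nAc; apply: (Amax G').
  split; first by move=> u Au; apply: sG'; right.
  by move=> sG'A; apply: nAc; right; exact: sG'A.
rewrite /P /mkset; suff -> : (G0 `|` G' = G')%classic by [].
by apply/setUidPr => u G0u; apply: sG'; left.
Qed.

End RealCase.

(** The functional to be extended is given by its graph, a linear relation; this
    spares the subspace on which it is defined. The extension is
    [v |-> g v - i g (i v)], for [g] a real extension of the real part; its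
    modulus is bounded by rotating the value at [v] onto the real axis. *)
Lemma hahn_banach (G : V -> R[i] -> Prop) (K : R) : 0 <= K ->
  (forall v a w b, G v a -> G w b -> G (v + w) (a + b)) ->
  (forall c v a, G v a -> G (c *: v) (c * a)) ->
  (forall v a, G v a -> cabs a <= K * rnorm v) ->
  exists f : dual V, rnorm f <= K /\ forall v a, G v a -> f v = a.
Proof.
move=> K0 GD GZ GK.
have [G00|nG] := pselect (exists v a, G v a); last first.
  exists 0; split; first by rewrite rnorm0.
  by move=> v a Gva; exfalso; apply: nG; exists v, a.
have {}G00 : G 0 0.
  by have [v [a /(GZ 0)]] := G00; rewrite scale0r mul0r.
pose p v := K * rnorm v.
pose G0 : set (V * R) := [set u | exists2 a, G u.1 a & u.2 = Re a]%classic.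
have [|||H [H0 HD HZ Hp] [sH Htot]] := @dominated_total p _ _ G0.
- by move=> v w; rewrite /p -mulrDr ler_wpM2l// rnormD.
- by move=> t v t0; rewrite /p rnZr// mulrCA.
- split.
  + by exists 0.
  + move=> [v r] [w s] [a Ga ->] [b Gb ->] /=; exists (a + b); first exact: GD.
    by case: a b {Ga Gb} => ? ? [].
  + move=> t [v r] [a Ga ->] /=; exists (t%:C * a); first exact: GZ.
    by case: a {Ga} => x y /=; rewrite mul0r subr0.
  + move=> [v r] [a Ga ->] /=; exact: le_trans (Re_le_cabs _) (GK _ _ Ga).
have [g gP] : exists g : V -> R, forall v, H (v, g v).
  by exists (fun v => projT1 (cid (Htot v))) => v; case: cid.
have Huniq v r s : H (v, r) -> H (v, s) -> r = s.
  have le r' s' : H (v, r') -> H (v, s') -> r' <= s'.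
    move=> Hr Hs; have /= := Hp _ (HD _ _ Hr (HZ (-1) _ Hs)).
    by rewrite rmorphN1 scaleN1r subrr /p rnorm0 mulr0 mulN1r subr_le0.
  by move=> Hr Hs; apply/eqP; rewrite eq_le !le.
have gD v w : g (v + w) = g v + g w by apply: Huniq (gP _) (HD _ _ (gP v) (gP w)).
have gZ t v : g (t%:C *: v) = t * g v by apply: Huniq (gP _) (HZ t _ (gP v)).
have gG v a : G v a -> g v = Re a.
  by move=> Gva; apply: Huniq (gP _) (sH (v, _) _); exists a.
pose f v : R[i]^o := (g v) +i* (- g ('i *: v)).
have fD v w : f (v + w) = f v + f w.
  by rewrite /f scalerDr !gD opprD.
have fZr t v : f (t%:C *: v) = t%:C *: f v.
  rewrite /f scalerA mulrC -scalerA !gZ.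
  by apply/eqP; rewrite eq_complex /=; apply/andP; split; apply/eqP; ring.
have fZi v : f ('i *: v) = 'i *: f v.
  have -> : f ('i *: v) = g ('i *: v) +i* g v.
    rewrite /f scalerA -expr2 sqr_i.
    have -> : -1 *: v = (-1 : R)%:C *: v by rewrite rmorphN1.
    by rewrite gZ mulN1r opprK.
  by apply/eqP; rewrite eq_complex /=; apply/andP; split; apply/eqP; ring.
have fZ a v : f (a *: v) = a *: f v.
  rewrite [a]complexE scalerDl fD fZr -scalerA fZi fZr scalerA -scalerDl.
  by [].
have fle v : cabs (f v) <= K * rnorm v.
  have [->|f0] := eqVneq (f v) 0; first by rewrite cabs0 mulr_ge0 ?rnorm_ge0.
  pose c : R[i] := (cabs (f v))%:C / f v.
  have cE : f (c *: v) = (cabs (f v))%:C by rewrite fZ /c /= -[LHS]mulrA mulVf// mulr1.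
  have cc : cabs c = 1.
    by rewrite /c cabsM cabsV cabs_pos ?cabs_ge0// mulfV// lt0r_neq0// cabs_gt0.
  have -> : cabs (f v) = g (c *: v) by move/(congr1 (@complex.Re R)): cE.
  by have /= := Hp _ (gP (c *: v)); rewrite /p rnZ cc mul1r.
have fbl : is_bounded_linear f.
  split; last by exists K.
  by move=> a v w; rewrite fD fZ.
exists (mkbop fbl); split.
  apply: opnorm_lub => v v1 /=; apply: le_trans (fle v) _.
  by rewrite -[leRHS]mulr1 ler_wpM2l.
move=> v a Gva /=; rewrite /f (gG _ _ Gva) (gG _ _ (GZ 'i _ _ Gva)).
by case: a {Gva} => x y; rewrite /= mul0r mul1r add0r opprK.
Qed.

Lemma norming_functional v : exists2 f : dual V, rnorm f <= 1 & f v = (rnorm v)%:C.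
Proof.
have [|||f [f1 fE]] := @hahn_banach
  (fun w a => exists c, w = c *: v /\ a = c * (rnorm v)%:C) 1 ler01.
- by move=> _ _ _ _ [c [-> ->]] [d [-> ->]]; exists (c + d); rewrite scalerDl mulrDl.
- by move=> b _ _ [c [-> ->]]; exists (b * c); rewrite scalerA mulrA.
- by move=> _ _ [c [-> ->]]; rewrite mul1r rnZ cabsM cabs_pos ?rnorm_ge0.
by exists f => //; apply: fE; exists 1; rewrite scale1r mul1r.
Qed.

Lemma dual_le (f : dual V) v : cabs (f v) <= rnorm f * rnorm v.
Proof. exact: (@opnorm_le R V R[i]^o f v). Qed.

Lemma dual_scale (f : dual V) a v : f (a *: v) = a * f v :> R[i].
Proof. exact: (@bop_scale R V R[i]^o f a v). Qed.

Lemma dual_separates v : (forall f : dual V, f v = 0) -> v = 0.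
Proof.
move=> fv; have [f _ fE] := norming_functional v.
by apply: rnorm_eq0; apply: complexI; rewrite -fE fv.
Qed.

End HahnBanach.

(** * Bounded below and openly surjective operators *)

Lemma half_pow_small (R : realType) (M e : R) : 0 < e ->
  exists n, M * 2^-1 ^+ n < e.
Proof.
move=> e0; have [M0|M0] := leP M 0.
  by exists 0%N; rewrite expr0 mulr1 (le_lt_trans M0).
have := archi_boundP (divr_ge0 (ltW M0) (ltW e0)); set n := Num.bound _ => Hn.
exists n; rewrite exprVn ltr_pdivrMr ?exprn_gt0// mulrC -ltr_pdivrMr//.
by apply: (lt_trans Hn); rewrite -natrX ltr_nat ltn_expl.
Qed.

Section Completeness.
Context (R : realType) (X : completeNormedModType R[i]).

(** Completeness is used in this form only: both the solution of an equation by
    successive approximation and the closedness of a range come from sequences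
    with geometrically decreasing steps. *)
Lemma geometric_limit (u : nat -> X) (M : R) :
  (forall n, rnorm (u n.+1 - u n) <= M * 2^-1 ^+ n) ->
  exists l, forall n, rnorm (l - u n) <= 2 * M * 2^-1 ^+ n.
Proof.
move=> uM.
have far n k : rnorm (u (n + k)%N - u n) <= 2 * M * 2^-1 ^+ n - 2 * M * 2^-1 ^+ (n + k).
  elim: k => [|k IH]; first by rewrite addn0 !subrr rnorm0.
  rewrite addnS -[_ - u n](subrKA (u (n + k)%N)) (le_trans (rnormD _ _))//.
  by have := uM (n + k)%N; rewrite [X in _ - _ * X]exprS; lra.
have M0 : 0 <= M by have := le_trans (rnorm_ge0 _) (uM 0%N); rewrite expr0 mulr1.
have pow_ge0 k : 0 <= 2 * M * 2^-1 ^+ k by rewrite !mulr_ge0 ?exprn_ge0 ?invr_ge0.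
have far' n m : (n <= m)%N -> rnorm (u m - u n) <= 2 * M * 2^-1 ^+ n.
  by move=> nm; have := far n (m - n)%N; rewrite subnKC//; have := pow_ge0 m; lra.
have : cvg (u @ \oo)%classic.
  apply/cauchy_cvgP/cauchyP => e e0.
  have eE : (Re e)%:C = e by apply: RRe_real; rewrite gtr0_real.
  have [n nP] : exists n, 2 * M * 2^-1 ^+ n < Re e.
    by apply: half_pow_small; rewrite -ltcR eE.
  exists (u n); exists n => //= m nm; rewrite -ball_normE /= -eE -rnormE ltcR.
  by rewrite rnB_sym (le_lt_trans _ nP)// far'.
move=> /cvg_ex[l ul]; exists l => n; apply/ler_addgt0Pr => e e0.
have e0' : 0 < e%:C by rewrite ltcR.
have [N _ NP] := (iffLR (cvgrPdist_lt _ _) ul) _ e0'.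
pose m := maxn N n; have /= := NP m (leq_maxl _ _); rewrite -rnormE ltcR => lm.
rewrite -[l - _](subrKA (u m)) (le_trans (rnormD _ _))//.
by have := far' n m (leq_maxr _ _); lra.
Qed.

End Completeness.

Section BoundedBelow.
Context (R : realType) (X Y : normedModType R[i]).
Implicit Types (S T : bop X Y) (C : R).

Definition below T C := forall z, rnorm z <= C * rnorm (T z).

Definition onto T C := forall y, exists2 z, T z = y & rnorm z <= C * rnorm y.

Lemma below_inj T C x y : below T C -> T x = T y -> x = y.
Proof.
move=> TC Txy; apply/eqP; rewrite -subr_eq0; apply/eqP; apply: rnorm_eq0.
apply/eqP; rewrite eq_le rnorm_ge0 andbT.
by have := TC (x - y); rewrite bop_sub /= Txy subrr rnorm0 mulr0.
Qed.

Lemma below_perturb T S C : below T C -> rnorm S * C <= 2^-1 -> 0 <= C ->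
  below (T + S) (2 * C).
Proof.
move=> TC SC C0 z; rewrite bopDE.
have h1 := rnD_ge (T z) (S z).
have h2 : rnorm (T z) <= rnorm (T z + S z) + rnorm S * rnorm z.
  by have := bop_le S z; lra.
have h3 := TC z.
have h4 : C * rnorm (T z) <= C * (rnorm (T z + S z) + rnorm S * rnorm z).
  by rewrite ler_wpM2l.
have h5 : rnorm S * C * rnorm z <= 2^-1 * rnorm z by rewrite ler_wpM2r ?rnorm_ge0.
by have h6 := rnorm_ge0 z; rewrite mulrDr mulrA [C * rnorm S]mulrC in h4; lra.
Qed.

Lemma belowZ T C a : below T C -> a != 0 -> below (a *: T) (C / cabs a).
Proof.
move=> TC a0 z; rewrite bopZE rnZ mulrA divfK ?lt0r_neq0 ?cabs_gt0//.
Qed.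

Lemma ontoZ T C a : onto T C -> a != 0 -> onto (a *: T) (C / cabs a).
Proof.
move=> TC a0 y; have [z Tz zC] := TC (a^-1 *: y).
exists z; first by rewrite bopZE Tz scalerA mulfV// scale1r.
by rewrite -mulrA -cabsV -rnZ.
Qed.

End BoundedBelow.

Section OntoPerturb.
Context (R : realType) (X : completeNormedModType R[i]) (Y : normedModType R[i]).

Lemma bop_zero_of_small (T : bop X Y) (z : X) (y : Y) (u : nat -> X) (M K : R) :
  (forall n, rnorm (z - u n) <= M * 2^-1 ^+ n) ->
  (forall n, rnorm (y - T (u n)) <= K * 2^-1 ^+ n) -> T z = y.
Proof.
move=> uM Tu; apply/eqP; rewrite -subr_eq0; apply/eqP/rnorm_eq0/eqP.
rewrite eq_le rnorm_ge0 andbT; apply/ler_addgt0Pr => e e0; rewrite add0r.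
have [n nP] := half_pow_small (rnorm T * M + K) e0.
apply: le_trans (ltW nP).
rewrite -[T z - y](subrKA (T (u n))) (le_trans (rnormD _ _))// mulrDl lerD//.
  rewrite -bop_sub /= (le_trans (bop_le _ _))// -mulrA ler_wpM2l ?rnorm_ge0//.
by rewrite rnB_sym.
Qed.

(** Successive approximation: lift [y] through [T], lift the error through
    [T], and so on; the errors halve at each step. *)
Lemma onto_perturb (T S : bop X Y) (C : R) : onto T C -> rnorm S * C <= 2^-1 -> 0 <= C ->
  onto (T + S) (2 * C).
Proof.
move=> TC SC C0 y.
have [h hP] : exists h : Y -> X, forall y, T (h y) = y /\ rnorm (h y) <= C * rnorm y.
  by exists (fun y => s2val (cid2 (TC y))) => y'; case: cid2.
pose e n := iter n (fun v => - S (h v)) y.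
have eS n : e n.+1 = - S (h (e n)) by [].
have en n : rnorm (e n) <= rnorm y * 2^-1 ^+ n.
  elim: n => [|n IH]; first by rewrite expr0 mulr1.
  rewrite eS rnN (le_trans (bop_le _ _))//.
  have h1 : rnorm S * rnorm (h (e n)) <= rnorm S * (C * rnorm (e n)).
    by rewrite ler_wpM2l ?rnorm_ge0//; case: (hP (e n)).
  have h2 : rnorm S * C * rnorm (e n) <= 2^-1 * rnorm (e n) by rewrite ler_wpM2r ?rnorm_ge0.
  by rewrite exprS; lra.
pose u n := \sum_(k < n) h (e k).
have uS n : u n.+1 - u n = h (e n) by rewrite /u big_ord_recr /= addrAC subrr add0r.
have [|z zP] := @geometric_limit _ _ u (C * rnorm y).
  move=> n; rewrite uS (le_trans (proj2 (hP _)))// -mulrA ler_wpM2l//.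
exists z; last first.
  by have := zP 0%N; rewrite /u big_ord0 subr0 expr0 mulr1 mulrA.
apply: (bop_zero_of_small zP (K := rnorm y)) => n.
suff -> : y - (T + S) (u n) = e n by [].
elim: n => [|n IH]; first by rewrite /u big_ord0 bop_zero subr0.
have -> : u n.+1 = u n + h (e n) by rewrite /u big_ord_recr.
have -> : (T + S) (u n + h (e n)) = (T + S) (u n) + (e n + S (h (e n))).
  by rewrite bop_add; congr (_ + _); rewrite bopDE (proj1 (hP (e n))).
by rewrite opprD addrA IH opprD addrA subrr add0r.
Qed.

(** The range of an operator that is bounded below is closed: vectors [z n] with
    [T (z n)] converging fast to [y] form themselves a convergent sequence. *)
Lemma below_closed_range (T : bop X Y) (C : R) (y : Y) : below T C -> 0 <= C ->
  (forall z, T z != y) -> exists2 d : R, 0 < d & forall z, d <= rnorm (y - T z).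
Proof.
move=> TC C0 Ty; apply: contrapT => nd.
have near n : exists z, rnorm (y - T z) < 2^-1 ^+ n.
  apply: contrapT => nz; apply: nd; exists (2^-1 ^+ n); first by rewrite exprn_gt0 ?invr_gt0.
  by move=> z; rewrite leNgt; apply/negP => zn; apply: nz; exists z.
pose u n := projT1 (cid (near n)).
have uP n : rnorm (y - T (u n)) < 2^-1 ^+ n by rewrite /u; case: cid.
have [|z zP] := @geometric_limit _ _ u (C * 2).
  move=> n; apply: le_trans (TC _) _; rewrite bop_sub -mulrA ler_wpM2l//=.
  rewrite -[_ - _](subrKA y) (le_trans (rnormD _ _))// rnB_sym.
  have := uP n; have := uP n.+1; rewrite exprS.
  have : 0 < 2^-1 ^+ n :> R by rewrite exprn_gt0 ?invr_gt0.
  by lra.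
apply: negP (Ty z) _; apply/eqP.
by apply: (bop_zero_of_small zP (K := 1)) => n; rewrite mul1r ltW.
Qed.

End OntoPerturb.

(** * Rank one perturbations *)

Section RankOne.
Context (R : realType) (X Y : normedModType R[i]).
Implicit Types (x : Y) (f : dual X) (T : bop X Y).

Lemma rank1_subproof x f : is_bounded_linear (fun z => f z *: x).
Proof.
split; first by move=> a u v; rewrite bop_add bop_scale scalerDl scalerA.
exists (rnorm f * rnorm x) => z; rewrite rnZ mulrAC.
by rewrite ler_wpM2r ?rnorm_ge0 ?dual_le.
Qed.

Definition rank1 x f : bop X Y := mkbop (rank1_subproof x f).

Lemma rank1E x f z : rank1 x f z = f z *: x.
Proof. by []. Qed.

Lemma bopBE T1 T2 v : (T1 - T2 : bop X Y) v = T1 v - T2 v.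
Proof. by []. Qed.

Lemma rank1Dl x y f : rank1 (x + y) f = rank1 x f + rank1 y f.
Proof. by apply: bop_ext => z; rewrite bopDE !rank1E scalerDr. Qed.

Lemma rank1Dr x f g : rank1 x (f + g) = rank1 x f + rank1 x g.
Proof. by apply: bop_ext => z; rewrite bopDE !rank1E bopDE scalerDl. Qed.

Lemma rank1Z a x f : rank1 (a *: x) f = rank1 x (a *: f).
Proof. by apply: bop_ext => z; rewrite !rank1E bopZE scalerA mulrC. Qed.

Lemma rank1_eq0 x f : rank1 x f = 0 -> x = 0 \/ f = 0.
Proof.
move=> F0; have [->|x0] := eqVneq x 0; [by left|right].
apply: bop_ext => z; have /(congr1 (fun F : bop X Y => F z)) := F0.
rewrite rank1E bop0E => /eqP; rewrite scaler_eq0 (negbTE x0) orbF => /eqP.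
by [].
Qed.

(** Passing to adjoints exchanges the two alternatives. As the maps in question
    may involve adjoints, only the union of the two classes can be preserved. *)
Definition semi_invertible T := exists2 C, 0 <= C & below T C \/ onto T C.

Lemma not_semi_invertible T u x : T u = 0 -> u != 0 -> (forall v, T v != x) ->
  ~ semi_invertible T.
Proof.
move=> Tu u0 Tx [C C0 [TC|TC]].
  by move/eqP: u0; apply; apply: (below_inj TC); rewrite Tu bop_zero.
by have [v Tv _] := TC x; have := Tx v; rewrite Tv eqxx.
Qed.

(** The vector [u] is in the kernel of the perturbed operator, and [x] is not
    in its range. *)
Lemma rank1_perturb_bad T x f u : T u = x -> f u = -1 ->
  (forall k, T k = 0 -> f k = 0) -> ~ semi_invertible (T + rank1 x f).
Proof.
move=> Tu fu kerf; apply: (@not_semi_invertible _ u x).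
- by rewrite bopDE rank1E fu scaleN1r Tu subrr.
- by apply: contra_eq_neq fu => ->; rewrite bop_zero eq_sym oppr_eq0 oner_eq0.
move=> v; apply/eqP; rewrite bopDE rank1E => Tv.
have := kerf (v + f v *: u - u); rewrite !bop_sub !bop_add dual_scale bop_scale Tu Tv subrr fu.
move/(_ erefl)/eqP; rewrite mulrN1 subrr add0r opprK.
by rewrite oner_eq0.
Qed.

(** A lift of [y] through [T] is corrected by a multiple of a fixed vector: of
    [k], which removes the value of [f], or of [u], which solves a scalar
    equation with coefficient [1 + f u]. *)
Lemma onto_rank1_perturb T x f C : onto T C -> 0 <= C ->
  (exists k, T k = 0 /\ f k != 0) \/ (exists u, T u = x /\ f u != -1) ->
  exists2 C', 0 <= C' & onto (T + rank1 x f) C'.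
Proof.
move=> TC C0 [[k [Tk fk]]|[u [Tu fu]]].
  exists ((1 + rnorm f * rnorm ((f k)^-1 *: k)) * C).
    by rewrite mulr_ge0// addr_ge0// mulr_ge0 ?rnorm_ge0.
  move=> y; have [z Tz zC] := TC y; exists (z - f z *: ((f k)^-1 *: k)).
    rewrite bopDE rank1E !bop_sub !dual_scale !bop_scale Tk !scaler0 subr0 Tz.
    by rewrite mulVf// mulr1 subrr scale0r addr0.
  rewrite (le_trans (rnB _ _))// rnZ.
  have h1 : cabs (f z) * rnorm ((f k)^-1 *: k) <= rnorm f * rnorm z * rnorm ((f k)^-1 *: k).
    by rewrite ler_wpM2r ?rnorm_ge0 ?dual_le.
  have h2 : (1 + rnorm f * rnorm ((f k)^-1 *: k)) * rnorm z
      <= (1 + rnorm f * rnorm ((f k)^-1 *: k)) * (C * rnorm y).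
    by rewrite ler_wpM2l// addr_ge0// mulr_ge0 ?rnorm_ge0.
  by rewrite -mulrA; lra.
have fu1 : 1 + f u != 0 by apply: contra fu; rewrite addrC addr_eq0.
pose q := rnorm f * rnorm ((1 + f u)^-1 *: u).
have q0 : 0 <= q by rewrite mulr_ge0 ?rnorm_ge0.
exists ((1 + q) * C); first by rewrite mulr_ge0// addr_ge0.
move=> y; have [z Tz zC] := TC y; exists (z - f z *: ((1 + f u)^-1 *: u)).
  rewrite bopDE rank1E !bop_sub !dual_scale !bop_scale Tu Tz -addrA.
  rewrite scalerA -scaleNr -scalerDl; set c : R[i] := (X in X *: x).
  suff -> : c = 0 by rewrite scale0r addr0.
  by rewrite /c; field.
rewrite (le_trans (rnB _ _))// rnZ.
have h1 : cabs (f z) * rnorm ((1 + f u)^-1 *: u) <= q * rnorm z.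
  by rewrite /q mulrAC ler_wpM2r ?rnorm_ge0 ?dual_le.
have h2 : (1 + q) * rnorm z <= (1 + q) * (C * rnorm y) by rewrite ler_wpM2l// addr_ge0.
by rewrite -mulrA; lra.
Qed.

(** With [T u = x] the perturbed operator is [T] after [z |-> z + f z *: u], and
    the latter is invertible as [1 + f u] is not zero. *)
Lemma below_rank1_perturb_range T x f C u : below T C -> 0 <= C ->
  T u = x -> f u != -1 -> exists2 C', 0 <= C' & below (T + rank1 x f) C'.
Proof.
move=> TC C0 Tu fu.
have fu1 : 1 + f u != 0 by apply: contra fu; rewrite addrC addr_eq0.
pose q := rnorm f * rnorm ((1 + f u)^-1 *: u).
have q0 : 0 <= q by rewrite mulr_ge0 ?rnorm_ge0.
exists ((1 + q) * C); first by rewrite mulr_ge0// addr_ge0.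
move=> z; rewrite bopDE rank1E -Tu -bop_scale -bop_add.
set w := z + f z *: u.
have zE : z = w - f w *: ((1 + f u)^-1 *: u).
  rewrite /w bop_add dual_scale scalerA -addrA -scalerBl.
  set c : R[i] := (X in X *: u).
  suff -> : c = 0 by rewrite scale0r addr0.
  by rewrite /c; field.
have h1 := rnB w (f w *: ((1 + f u)^-1 *: u)).
have h2 : rnorm (f w *: ((1 + f u)^-1 *: u)) <= q * rnorm w.
  by rewrite rnZ /q mulrAC ler_wpM2r ?rnorm_ge0 ?dual_le.
have h3 : (1 + q) * rnorm w <= (1 + q) * (C * rnorm (T w)) by rewrite ler_wpM2l ?addr_ge0.
by rewrite -mulrA {1}zE; lra.
Qed.

Definition invertible T := exists2 C, 0 <= C & below T C /\ onto T C.

Lemma invertible_semi T : invertible T -> semi_invertible T.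
Proof. by move=> [C C0 [TC _]]; exists C => //; left. Qed.

Lemma invertible_of T C C' : 0 <= C -> 0 <= C' -> below T C -> onto T C' -> invertible T.
Proof.
move=> C0 C'0 TC TC'; exists (C + C'); first by rewrite addr_ge0.
split=> [z|y].
  by apply: le_trans (TC z) _; rewrite ler_wpM2r ?rnorm_ge0// lerDl.
have [z Tz zC] := TC' y; exists z => //.
by apply: le_trans zC _; rewrite ler_wpM2r ?rnorm_ge0// lerDr.
Qed.

Lemma invertible_inj T u : invertible T -> T u = 0 -> u = 0.
Proof. by move=> [C _ [TC _]] Tu; apply: (below_inj TC); rewrite Tu bop_zero. Qed.

Lemma invertible_surj T x : invertible T -> exists u, T u = x.
Proof. by move=> [C _ [_ TC]]; have [u Tu _] := TC x; exists u. Qed.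

Lemma invertible_rank1 T x f u : invertible T -> T u = x -> f u != -1 ->
  invertible (T + rank1 x f).
Proof.
move=> [C C0 [Tb To]] Tu fu.
have [B B0 TB] := below_rank1_perturb_range Tb C0 Tu fu.
have [D D0 TD] : exists2 C', 0 <= C' & onto (T + rank1 x f) C'.
  by apply: onto_rank1_perturb To C0 _; right; exists u.
exact: invertible_of TB TD.
Qed.

End RankOne.

Section RankOneComplete.
Context (R : realType) (X : completeNormedModType R[i]) (Y : normedModType R[i]).
Implicit Types (x : Y) (f : dual X) (T : bop X Y).

(** The distance from [x] to the range controls [f z], hence [T z], by the
    perturbed value at [z]. *)
Lemma below_rank1_perturb_out T x f C : below T C -> 0 <= C ->
  (forall z, T z != x) -> semi_invertible (T + rank1 x f).
Proof.
move=> TC C0 Tx; have [d d0 dP] := below_closed_range TC C0 Tx.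
pose q := rnorm x / d; have q0 : 0 <= q by rewrite divr_ge0 ?rnorm_ge0 ?ltW.
exists (C * (1 + q)); first by rewrite mulr_ge0// addr_ge0.
left=> z; rewrite bopDE rank1E; set N := rnorm (_ + _).
have fzN : cabs (f z) * d <= N.
  have [->|fz] := eqVneq (f z) 0; first by rewrite cabs0 mul0r rnorm_ge0.
  have -> : N = cabs (f z) * rnorm (x - T (- (f z)^-1 *: z)).
    rewrite -rnZ scalerBr bop_scale scaleNr scalerN opprK scalerA mulfV// scale1r.
    by rewrite /N addrC.
  by rewrite ler_wpM2l ?cabs_ge0.
have h1 : cabs (f z) * rnorm x <= q * N.
  have fzd : cabs (f z) <= N / d by rewrite ler_pdivlMr.
  by rewrite (_ : q * N = N / d * rnorm x) ?ler_wpM2r ?rnorm_ge0// /q; ring.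
have h2 : rnorm (T z) <= N + cabs (f z) * rnorm x.
  by have := rnD_ge (T z) (f z *: x); rewrite rnZ -/N; lra.
apply: le_trans (TC z) _; rewrite -mulrA ler_wpM2l// mulrDl mul1r.
by lra.
Qed.

Lemma rank1_perturb_badP T x f : semi_invertible T -> ~ semi_invertible (T + rank1 x f) ->
  exists u, [/\ T u = x, f u = -1 & forall k, T k = 0 -> f k = 0].
Proof.
move=> [C C0 [TC|TC]] bad.
  have [[u Tu]|nu] := pselect (exists u, T u = x); last first.
    exfalso; apply: bad; apply: below_rank1_perturb_out TC C0 _ => z.
    by apply/eqP => Tz; apply: nu; exists z.
  exists u; split=> //.
    apply/eqP; apply: contrapT => /negP fu; apply: bad.
    by have [C' C'0 TC'] := below_rank1_perturb_range TC C0 Tu fu; exists C' => //; left.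
  move=> k Tk; suff -> : k = 0 by rewrite bop_zero.
  by apply: (below_inj TC); rewrite Tk bop_zero.
have [u Tu _] := TC x; exists u; split=> //.
  apply/eqP; apply: contrapT => /negP fu.
  have [|C' C'0 TC'] := @onto_rank1_perturb _ _ _ T x f C TC C0; first by right; exists u.
  by apply: bad; exists C' => //; right.
move=> k Tk; apply/eqP; apply: contrapT => /negP fk.
have [|C' C'0 TC'] := @onto_rank1_perturb _ _ _ T x f C TC C0; first by left; exists k.
by apply: bad; exists C' => //; right.
Qed.

(** A bad rank one perturbation pins the value of [f] at every preimage of
    [x] to be [-1]; doubling [f] therefore leads out of the bad set. *)
Lemma rank1_semi_alternative T x f : semi_invertible T ->
  semi_invertible (T + rank1 x f) \/ semi_invertible (T + (rank1 x f + rank1 x f)).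
Proof.
move=> sT; apply: contrapT => /not_orP[bad1].
rewrite -rank1Dr => bad2.
have [u [Tu fu kf]] := rank1_perturb_badP sT bad1.
have [v [Tv fv _]] := rank1_perturb_badP sT bad2.
have := kf (u - v); rewrite !bop_sub Tu Tv subrr => /(_ erefl)/eqP.
rewrite subr_eq0 fu => /eqP fv1; move: fv; rewrite bopDE -fv1 => /eqP.
by rewrite -subr_eq0 opprK subrK oppr_eq0 oner_eq0.
Qed.

End RankOneComplete.

(** * The reduced minimum modulus *)

Section Distance.
Context (R : realType) (X : normedModType R[i]).
Implicit Types (A : set X) (z w : X).

Lemma dist_le A z w : A w -> dist_to A z <= rnorm (z - w).
Proof.
move=> Aw; apply: ge_inf; last by exists w.
by exists 0 => _ [v _ <-]; exact: rnorm_ge0.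
Qed.

Lemma dist_ge A z w c : A w -> (forall v, A v -> c <= rnorm (z - v)) -> c <= dist_to A z.
Proof.
move=> Aw cA; apply: lb_le_inf; first by exists (rnorm (z - w)), w.
by move=> _ [v Av <-]; exact: cA.
Qed.

Lemma dist_approx A z w e : A w -> 0 < e ->
  exists2 v, A v & rnorm (z - v) <= dist_to A z + e.
Proof.
move=> Aw e0; apply: contrapT => nv.
suff : dist_to A z + e <= dist_to A z by rewrite gerDl leNgt e0.
apply: (dist_ge Aw) => v Av; rewrite leNgt; apply/negP => zv.
by apply: nv; exists v => //; exact: ltW.
Qed.

End Distance.

Section Gamma.
Context (R : realType) (X Y : normedModType R[i]).
Implicit Types (S T : bop X Y) (c C : R).

Lemma kernel0 T : kernel T 0.
Proof. exact: bop_zero. Qed.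

Lemma gamma_ge T c : (forall z, 1 <= dist_to (kernel T) z -> c <= rnorm (T z)) ->
  (c%:E <= red_min_modulus T)%E.
Proof.
move=> cT; rewrite /red_min_modulus; case: ifP => _; first exact: leey.
by apply: le_ereal_inf_tmp => _ [z /= z1 <-]; rewrite lee_fin cT.
Qed.

Lemma gamma_le T z : T != 0 -> 1 <= dist_to (kernel T) z ->
  (red_min_modulus T <= (rnorm (T z))%:E)%E.
Proof.
move=> T0 z1; rewrite /red_min_modulus (negbTE T0).
by apply: ereal_inf_lbound; exists z.
Qed.

(** The definition of gamma, freed from the normalization of the distance. *)
Lemma gamma_bound T c z : 0 <= c -> (c%:E <= red_min_modulus T)%E ->
  c * dist_to (kernel T) z <= rnorm (T z).
Proof.
move=> c0 cT; have [T0|T0] := eqVneq T 0.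
  rewrite T0 bop0E rnorm0 mulr_ge0_le0//.
  by have := @dist_le _ _ (kernel T) z z; rewrite T0 subrr rnorm0; apply.
have [d0|d0] := leP (dist_to (kernel T) z) 0.
  exact: le_trans (mulr_ge0_le0 c0 d0) (rnorm_ge0 _).
set d := dist_to _ _ in d0 *; have d1 : 0 <= d^-1 by rewrite invr_ge0 ltW.
have : 1 <= dist_to (kernel T) ((d^-1)%:C *: z).
  apply: (dist_ge (kernel0 T)) => v Tv.
  have -> : (d^-1)%:C *: z - v = (d^-1)%:C *: (z - d%:C *: v).
    by rewrite scalerBr scalerA -rmorphM mulVf ?gt_eqF// scale1r.
  rewrite rnZr// mulrC ler_pdivlMr// mul1r dist_le//.
  by rewrite /kernel /= bop_scale Tv scaler0.
move=> /(gamma_le T0) /(le_trans cT); rewrite lee_fin bop_scale rnZr//.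
by rewrite mulrC ler_pdivlMr.
Qed.

Lemma below_gamma T C : below T C -> 0 < C -> ((C^-1)%:E <= red_min_modulus T)%E.
Proof.
move=> TC C0; apply: gamma_ge => z /le_trans/(_ (dist_le z (kernel0 T))).
rewrite subr0 => z1; rewrite -[leLHS]mul1r ler_pdivrMr// mulrC.
exact: le_trans z1 (TC z).
Qed.

Lemma onto_gamma T C : onto T C -> 0 < C -> ((C^-1)%:E <= red_min_modulus T)%E.
Proof.
move=> TC C0; apply: gamma_ge => z z1; rewrite -[leLHS]mul1r ler_pdivrMr// mulrC.
have [w Tw wC] := TC (T z); apply: le_trans wC; apply: le_trans z1 _.
have -> : w = z - (z - w) by rewrite opprB addrC subrK.
by apply: dist_le; rewrite /kernel /= bop_sub Tw subrr.
Qed.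

Lemma gamma_semi T c : 0 < c -> (c%:E <= red_min_modulus T)%E ->
  (forall u, T u = 0 -> u = 0) \/ (forall x, exists v, T v = x) -> semi_invertible T.
Proof.
move=> c0 cT [inj|surj].
  exists c^-1; first by rewrite invr_ge0 ltW.
  left=> z; rewrite mulrC ler_pdivlMr// mulrC.
  apply: le_trans (gamma_bound z (ltW c0) cT); rewrite (ler_wpM2l (ltW c0))//.
  apply: (dist_ge (kernel0 T)) => v /inj ->; by rewrite subr0.
exists (c^-1 + 1); first by rewrite addr_ge0// invr_ge0 ltW.
right=> y; have [z Tz] := surj y.
have [->|y0] := eqVneq y 0; first by exists 0; rewrite ?bop_zero// !rnorm0 mulr0.
have [k Tk kd] := dist_approx z (kernel0 T) (rn_gt0 y0).
exists (z - k); first by rewrite bop_sub Tk subr0.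
apply: le_trans kd _; rewrite mulrDl mul1r lerD2r mulrC ler_pdivlMr// mulrC.
by rewrite -Tz; exact: gamma_bound (ltW c0) cT.
Qed.

(** The kernel is a hyperplane, at distance [cabs (f z) / rnorm f] from [z]. *)
Lemma rank1_gamma (x : Y) (f : dual X) : rank1 x f != 0 ->
  red_min_modulus (rank1 x f) = (rnorm x * rnorm f)%:E.
Proof.
move=> F0.
have x0 : x != 0.
  by apply: contra_neq F0 => ->; apply: bop_ext => z; rewrite rank1E scaler0.
have f0 : f != 0.
  by apply: contra_neq F0 => ->; apply: bop_ext => z; rewrite rank1E scale0r.
have kerE z : kernel (rank1 x f) z <-> f z = 0.
  rewrite /kernel /mkset rank1E; split=> [/eqP|->]; last by rewrite scale0r.
  by rewrite scaler_eq0 (negbTE x0) orbF => /eqP.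
apply/eqP; rewrite eq_le; apply/andP; split.
  have [u fu] : exists u, f u != 0.
    apply: contrapT => nu; move/eqP: f0; apply; apply: bop_ext => z.
    by apply/eqP; apply: contrapT => /negP fz; apply: nu; exists z.
  pose z := ((rnorm f)%:C / f u) *: u.
  have fz : f z = (rnorm f)%:C by rewrite dual_scale divfK.
  have := @gamma_le (rank1 x f) z F0.
  rewrite rank1E rnZ fz cabs_pos ?rnorm_ge0// mulrC; apply.
  apply: (dist_ge (kernel0 _)) => v /kerE fv.
  have := dual_le f (z - v); rewrite bop_sub fv subr0 fz cabs_pos ?rnorm_ge0//.
  by rewrite -[X in X <= _ -> _]mulr1 ler_pM2l// rn_gt0.
apply: gamma_ge => z z1; rewrite rank1E rnZ mulrC ler_wpM2r ?rnorm_ge0//.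
apply: opnorm_lub => v v1; have [fv|fv] := eqVneq (f v) 0.
  by rewrite fv rnorm0 cabs_ge0.
have : kernel (rank1 x f) (z - (f z / f v) *: v).
  by apply/kerE; rewrite bop_sub dual_scale divfK// subrr.
move=> /(dist_le z)/(le_trans z1); rewrite opprB addrC subrK rnZ cabsM cabsV.
rewrite mulrAC ler_pdivlMr ?cabs_gt0// mul1r => /le_trans; apply.
by rewrite ler_piMr ?cabs_ge0.
Qed.

End Gamma.

(** * Semi-invertibility is a property of the reduced minimum modulus *)

Section Stability.
Context (R : realType) (X : completeNormedModType R[i]).
Implicit Types (S T : bop X X).

(** The condition [S' *+ n.+1 = S] says that [S' = S / (n + 1)] in the only
    terms that an additive map can see. *)
Definition perturbation_stable T := forall S, exists2 c : R, 0 < c &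
  exists N, forall n, (N <= n)%N -> forall S', S' *+ n.+1 = S ->
    (c%:E <= red_min_modulus (T + S')%R)%E.

Lemma natC n : (n%:R : R[i]) = (n%:R : R)%:C.
Proof. by rewrite rmorph_nat. Qed.

Lemma rnorm_mulrn (V : normedModType R[i]) (v : V) n : rnorm (v *+ n) = n%:R * rnorm v.
Proof. by rewrite -scaler_nat natC rnZr. Qed.

(** For an onto or bounded below [T], stability is openness of these classes.
    If [T] is neither injective nor surjective, take [u] in the kernel with [f u = 1]
    and [x] outside the range: then [(T + rank1 x f / n) u = x / n] although
    [u] stays at a fixed distance from the new kernel. *)
Lemma perturbation_stableP T : perturbation_stable T <-> semi_invertible T.
Proof.
split=> [sT|[C C0 TC] S].
  have [c c0 [N NP]] := sT 0.
  have cT : (c%:E <= red_min_modulus T)%E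
    by have := NP N (leqnn N) 0; rewrite addr0; apply; rewrite mul0rn.
  apply: (gamma_semi c0 cT); apply: contrapT => /not_orP[ninj nsurj].
  have [u [Tu u0]] : exists u, T u = 0 /\ u <> 0.
    apply: contrapT => nu; apply: ninj => u Tu; apply: contrapT => u0.
    by apply: nu; exists u.
  have [x Tx] : exists x, forall v, T v <> x.
    apply: contrapT => nx; apply: nsurj => x; apply: contrapT => nv.
    by apply: nx; exists x => v Tv; apply: nv; exists v.
  have {}u0 : 0 < rnorm u by apply: rn_gt0; apply/eqP.
  have [f f1 fu] := norming_functional u.
  pose z := ((rnorm u)^-1)%:C *: u.
  have fz : f z = 1 by rewrite dual_scale fu -rmorphM mulVf ?gt_eqF.
  have Tz : T z = 0 by rewrite bop_scale Tu scaler0.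
  have [d d0 [M MP]] := sT (rank1 x f).
  have [m mP] : exists m, (M <= m)%N /\ rnorm x < d * m.+1%:R.
    have := archi_boundP (divr_ge0 (rnorm_ge0 x) (ltW d0)); set k := Num.bound _ => kP.
    exists (maxn M k); split; first exact: leq_maxl.
    rewrite mulrC -ltr_pdivrMr//; apply: lt_le_trans kP _.
    by rewrite ler_nat ltnW// ltnS leq_maxr.
  case: mP => Mm xm.
  pose S' := (m.+1%:R : R[i])^-1 *: rank1 x f.
  have S'S : S' *+ m.+1 = rank1 x f.
    by rewrite -scaler_nat scalerA mulfV ?pnatr_eq0// scale1r.
  have S'z : (T + S') z = (m.+1%:R : R[i])^-1 *: x.
    by rewrite bopDE Tz add0r bopZE rank1E fz scale1r.
  have x0 : x != 0 by apply/eqP => x0; apply: (Tx 0); rewrite bop_zero.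
  have TS0 : T + S' != 0.
    apply/eqP => TS0; move: S'z; rewrite TS0 bop0E => /esym/eqP.
    by rewrite scaler_eq0 invr_eq0 pnatr_eq0 (negbTE x0).
  have : (red_min_modulus (T + S')%R <= (rnorm ((T + S')%R z))%:E)%E.
    apply: gamma_le => //; apply: (dist_ge (kernel0 _)) => v.
    rewrite /kernel /mkset bopDE bopZE rank1E => Tv.
    have fv : f v = 0.
      apply/eqP; apply: contrapT => /negP fv.
      apply: (Tx (- (m.+1%:R / f v) *: v)); rewrite bop_scale.
      move/eqP: Tv; rewrite addr_eq0 => /eqP ->.
      rewrite scaleNr scalerN opprK !scalerA; set a : R[i] := (X in X *: x).
      suff -> : a = 1 by rewrite scale1r.
      have m0 : (m.+1%:R : R[i]) != 0 by rewrite pnatr_eq0.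
      by rewrite /a; move: (m.+1%:R : R[i]) m0 => k k0; field; rewrite k0 fv.
    have := dual_le f (z - v); rewrite bop_sub fv subr0 fz cabs1 => /le_trans; apply.
    by rewrite ler_piMl ?rnorm_ge0.
  move=> /(le_trans (MP m Mm S' S'S)); rewrite S'z rnZ cabsV natC cabs_pos// lee_fin.
  by rewrite mulrC ler_pdivlMr// leNgt xm.
pose K := C + 1; have K0 : 0 < K by rewrite ltr_wpDl.
have KC : C <= K by rewrite lerDl.
exists (2 * K)^-1; first by rewrite invr_gt0 mulr_gt0.
have SK0 : 0 <= 2 * (rnorm S * K) by rewrite !mulr_ge0 ?rnorm_ge0 ?ltW.
have := archi_boundP SK0; set N := Num.bound _ => NP; exists N => n Nn S' S'S.
have S'K : rnorm S' * K <= 2^-1.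
  have := NP; rewrite -S'S rnorm_mulrn => H.
  have Nn1 : (N%:R : R) <= n.+1%:R by rewrite ler_nat ltnW.
  have h : n.+1%:R * (2 * (rnorm S' * K)) < n.+1%:R * 1 :> R.
    by rewrite mulr1; apply: lt_le_trans Nn1; rewrite (le_lt_trans _ H)// mulrCA -mulrA.
  by rewrite ltr_pM2l ?ltr0n// in h; lra.
case: TC => TC.
  apply: below_gamma; last by rewrite mulr_gt0.
  apply: below_perturb S'K (ltW K0) => z.
  by apply: le_trans (TC z) _; rewrite ler_wpM2r ?rnorm_ge0.
apply: onto_gamma; last by rewrite mulr_gt0.
apply: onto_perturb S'K (ltW K0) => y; have [z Tz zC] := TC y.
by exists z => //; apply: le_trans zC _; rewrite ler_wpM2r ?rnorm_ge0.
Qed.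

End Stability.

(** * Rank one operators are determined by semi-invertibility *)

Section Functionals.
Context (R : realType) (V : normedModType R[i]).
Implicit Types (a b v : V) (f : dual V).

Lemma functional_one v : v != 0 -> exists f : dual V, f v = 1.
Proof.
move=> v0; have [f _ fv] := norming_functional v.
exists (((rnorm v)^-1)%:C *: f); rewrite bopZE fv.
by rewrite /GRing.scale /= -rmorphM mulVf ?rmorph1// gt_eqF// rn_gt0.
Qed.

Lemma functional_one_zero a b : (forall c, a <> c *: b) ->
  exists f : dual V, f a = 1 /\ f b = 0.
Proof.
move=> ab; have [b0|b0] := eqVneq b 0.
  have [|f fa] := @functional_one a; first by apply/eqP => a0; apply: (ab 0); rewrite scale0r.
  by exists f; rewrite b0 bop_zero.
have [h hb] := functional_one b0.
have [|f fab] := @functional_one (a - h a *: b).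
  by rewrite subr_eq0; apply/eqP; exact: ab.
exists (f - f b *: h); rewrite !bopBE !bopZE hb; split.
  by rewrite -fab bop_sub dual_scale /GRing.scale /= mulrC.
by rewrite /GRing.scale /= mulr1 subrr.
Qed.

(** One of [f], [g] and [f + g] works. *)
Lemma functional_both_neq0 (P : dual V -> Prop) a b :
  (forall f g, P f -> P g -> P (f + g)) ->
  (exists2 f, P f & f a != 0) -> (exists2 g, P g & g b != 0) ->
  exists2 h, P h & (h a != 0) && (h b != 0).
Proof.
move=> PD [f Pf fa] [g Pg gb].
have [fb|fb] := eqVneq (f b) 0; last by exists f => //; rewrite fa.
have [ga|ga] := eqVneq (g a) 0; last by exists g => //; rewrite ga.
by exists (f + g); [exact: PD|rewrite !bopDE ga fb addr0 add0r fa].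
Qed.

End Functionals.

Section Characterization.
Context (R : realType) (X : completeNormedModType R[i]).
Implicit Types (A T : bop X X).

Lemma id_subproof : is_bounded_linear (fun x : X => x).
Proof. by split=> //; exists 1 => x; rewrite mul1r. Qed.

Definition bop_id : bop X X := mkbop id_subproof.

Lemma invertible_id : invertible bop_id.
Proof.
by exists 1 => //; split=> [z|z]; [rewrite mul1r|exists z => //; rewrite mul1r].
Qed.

Lemma invertible_large T A : invertible T ->
  exists2 r0 : R, 0 < r0 & forall r, r0 <= r -> invertible (r%:C *: T + A).
Proof.
move=> [C C0 [Tb To]].
have q0 : 0 <= 2 * (rnorm A * C) by rewrite !mulr_ge0 ?rnorm_ge0.
exists (2 * (rnorm A * C) + 1); first by rewrite ltr_wpDl.
move=> r r1; have r0 : 0 < r by apply: lt_le_trans r1; rewrite ltr_wpDl.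
have rC0 : r%:C != 0 :> R[i] by apply/eqP => /complexI r00; rewrite r00 ltxx in r0.
have Cr0 : 0 <= C / r by rewrite divr_ge0// ltW.
have small : rnorm A * (C / r) <= 2^-1 by rewrite mulrA ler_pdivrMr//; lra.
have := belowZ Tb rC0; rewrite cabs_pos ?(ltW r0)// => Tb'.
have := ontoZ To rC0; rewrite cabs_pos ?(ltW r0)// => To'.
apply: (invertible_of _ _ (below_perturb Tb' small Cr0) (onto_perturb To' small Cr0)).
- by rewrite mulr_ge0.
- by rewrite mulr_ge0.
Qed.

Definition rank_le1 A := exists x f, A = rank1 x f.

Lemma rank_le1_of_range A y : y != 0 -> (forall z, exists c, A z = c *: y) -> rank_le1 A.
Proof.
move=> y0 Ay; have [g gy] := functional_one y0.
exists y, (bop_comp g A); apply: bop_ext => z; rewrite rank1E /=.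
by have [c ->] := Ay z; rewrite dual_scale gy mulr1.
Qed.

Lemma not_rank_le1 A : ~ rank_le1 A ->
  exists w w', A w != 0 /\ forall c, A w' <> c *: A w.
Proof.
move=> nA.
have [w Aw] : exists w, A w != 0.
  apply: contrapT => nw; apply: nA; exists 0, 0; apply: bop_ext => z.
  rewrite rank1E scaler0; apply/eqP; apply: contrapT => /negP Az.
  by apply: nw; exists z.
have [w' Aw'] : exists w', forall c, A w' <> c *: A w.
  apply: contrapT => nw; apply: nA; apply: (rank_le1_of_range Aw) => z.
  apply: contrapT => nc; apply: nw; exists z => c Az; apply: nc.
  by exists c.
by exists w, w'.
Qed.

(** If [A w = y] and [A w' = y'] are independent, choose an invertible [T0]
    with [T0 w' = t y], [t] large enough for [T0 + A] and [T0 + A + A] to be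
    invertible. For [u1 = w + (2/t) w'] and [u2 = w + (1/t) w'] the vectors
    [(T0 + A) u1] and [(T0 + A + A) u2] coincide; call them [x]. A functional
    [f] equal to [-1] at both [u1] and [u2], but not at the preimage of [x]
    under [T0], makes [T0 + rank1 x f] invertible while its shifts by [A] and
    [A + A] are not semi-invertible. *)
Lemma semi_alternative_rank_le1 A :
  (forall T, semi_invertible T -> semi_invertible (T + A) \/ semi_invertible (T + (A + A))) ->
  rank_le1 A.
Proof.
move=> alt; apply: contrapT => /not_rank_le1[w [w' []]].
set y := A w; set y' := A w' => y0 yy'.
have w'0 : w' != 0.
  by apply/eqP => w'0; apply: (yy' 0); rewrite scale0r /y' w'0 bop_zero.
have [h _ /andP[hw' hy]] : exists2 h : dual X, True & (h w' != 0) && (h y != 0).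
  have [p pw] := functional_one w'0; have [q qy] := functional_one y0.
  apply: (functional_both_neq0 (P := fun _ => True)) => //.
    by exists p => //; rewrite pw oner_eq0.
  by exists q => //; rewrite qy oner_eq0.
pose g : dual X := (h w')^-1 *: h.
have gw' : g w' = 1 by rewrite bopZE /GRing.scale /= mulVf.
have gy : g y != 0 by rewrite bopZE /GRing.scale /= mulf_neq0// invr_eq0.
pose J := bop_id + rank1 (y - w') g.
have Jw' : J w' = y by rewrite bopDE rank1E gw' scale1r addrC subrK.
have iJ : invertible J.
  apply: (invertible_rank1 (u := y - w') invertible_id) => //.
  by rewrite bop_sub gw' -subr_eq0 opprK subrK.
have [r1 r10 iA] := invertible_large A iJ.
have [r2 r20 iAA] := invertible_large (A + A) iJ.
have [r3 r30 i0] := invertible_large 0 iJ.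
pose r := r1 + r2 + r3; pose t : R[i] := r%:C.
have r0 : 0 < r by rewrite !addr_gt0.
have t0 : t != 0 by apply/eqP => /complexI r00; rewrite r00 ltxx in r0.
pose T0 := t *: J.
have {}iA : invertible (T0 + A) by apply: iA; rewrite /r; lra.
have {}iAA : invertible (T0 + (A + A)) by apply: iAA; rewrite /r; lra.
have {}i0 : invertible T0 by rewrite -[T0]addr0; apply: i0; rewrite /r; lra.
have T0w' : T0 w' = t *: y by rewrite bopZE Jw'.
have [k T0k] := invertible_surj y' i0.
have [f [fw' fw] fk] : exists2 f : dual X, f w' = 0 /\ f w = -1 & f k != 0.
  have ww' c : w <> c *: w'.
    move=> wc; have yc : y = c *: y' by rewrite /y wc bop_scale.
    have c0 : c != 0 by apply: contra_neq y0 => c0; rewrite yc c0 scale0r.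
    by apply: (yy' c^-1); rewrite yc scalerA mulVf// scale1r.
  have kw' c : k <> c *: w'.
    move=> kc; apply: (yy' (c * t)); rewrite -T0k kc bop_scale T0w' scalerA.
    by [].
  have [p [pw pw']] := functional_one_zero ww'.
  have [q [qk qw']] := functional_one_zero kw'.
  have [|||f fw' /andP[fw fk]] :=
      @functional_both_neq0 R X (fun f => f w' = 0) w k.
  - by move=> f1 f2 f10 f20; rewrite bopDE f10 f20 addr0.
  - by exists p => //; rewrite pw oner_eq0.
  - by exists q => //; rewrite qk oner_eq0.
  exists (- (f w)^-1 *: f); rewrite !bopZE.
    by rewrite fw' scaler0 /GRing.scale /= mulNr mulVf.
  by rewrite /GRing.scale /= mulf_neq0// oppr_eq0 invr_eq0.
pose x := T0 w + 3 *: y + (2 / t) *: y'.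
have iT : invertible (T0 + rank1 x f).
  apply: (invertible_rank1 (u := w + (3 / t) *: w' + (2 / t) *: k) i0).
    by rewrite !bop_add !bop_scale T0k T0w' scalerA divfK.
  rewrite !bop_add !dual_scale fw fw' mulr0 addr0 -subr_eq0 opprK addrAC addNr add0r.
  by rewrite mulf_neq0// mulf_neq0 ?invr_eq0// pnatr_eq0.
have bad B u : invertible (T0 + B) -> (T0 + B) u = x -> f u = -1 ->
    ~ semi_invertible (T0 + rank1 x f + B).
  move=> iB Bu fu; rewrite addrAC; apply: (rank1_perturb_bad Bu fu) => z Bz.
  by rewrite (invertible_inj iB Bz) bop_zero.
have fu c : f (w + c *: w') = -1 by rewrite bop_add dual_scale fw' mulr0 addr0.
case: (alt _ (invertible_semi iT)).
  apply: (bad _ (w + (2 / t) *: w')) => //.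
  have e : 2 *: y + y = 3 *: y by rewrite -[X in _ + X]scale1r -scalerDl -(natrD _ 2 1).
  rewrite bopDE !bop_add !bop_scale T0w' scalerA divfK// -/y -/y' /x.
  rewrite [LHS]addrA -[T0 w + _ + y]addrA e. by [].
apply: (bad _ (w + (1 / t) *: w')) => //.
have e : y + (y + y) = 3 *: y by rewrite scaler_nat.
rewrite !bopDE !bop_add !bop_scale T0w' scalerA divfK// -/y -/y' /x scale1r.
rewrite [y + _ + (y + _)]addrACA -scalerDl -mulrDl [LHS]addrA -[T0 w + _ + (_ + _)]addrA e.
by [].
Qed.

End Characterization.

(** * Additive maps preserving elementary tensors *)

Section Parallel.
Context (K : fieldType) (V : lmodType K).
Implicit Types (u v w : V).

Definition parallel u v := u = 0 \/ exists c : K, v = c *: u.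

Lemma parallel_sym u v : parallel u v -> parallel v u.
Proof.
move=> [->|[c ->]]; first by right; exists 0; rewrite scale0r.
have [->|c0] := eqVneq c 0; first by left; rewrite scale0r.
by right; exists c^-1; rewrite scalerA mulVf// scale1r.
Qed.

Lemma parallel_trans u v w : v != 0 -> parallel u v -> parallel v w -> parallel u w.
Proof.
move=> v0 [->|[c vE]]; first by left.
move=> [v0'|[d ->]]; first by rewrite v0' eqxx in v0.
by right; exists (d * c); rewrite vE scalerA.
Qed.

Lemma parallelE u v : u != 0 -> parallel u v -> exists c, v = c *: u.
Proof. by move=> u0 [u0'|//]; rewrite u0' eqxx in u0. Qed.

Lemma not_parallel_neq0 u v : ~ parallel u v -> u != 0 /\ v != 0.
Proof.
move=> uv; split; apply/eqP => e; apply: uv; first by left.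
by right; exists 0; rewrite e scale0r.
Qed.

Lemma not_parallel_free u v a b : ~ parallel u v -> a *: u + b *: v = 0 -> a = 0 /\ b = 0.
Proof.
move=> uv abE; have [u0 _] := not_parallel_neq0 uv.
have b0 : b = 0.
  apply/eqP; apply: contrapT => /negP b0; apply: uv; right; exists (- (b^-1 * a)).
  move/eqP: abE; rewrite addrC addr_eq0 => /eqP bv.
  by rewrite scaleNr -scalerA -scalerN -bv scalerA mulVf// scale1r.
move/eqP: abE; rewrite b0 scale0r addr0 scaler_eq0 (negbTE u0) orbF => /eqP.
by [].
Qed.

Definition not_a_line := (exists u, u != 0) /\ forall u, u != 0 -> exists v, ~ parallel u v.

End Parallel.

(** An abstract product with just enough properties to recognize which pairs
    of elementary tensors share a factor. The definition is symmetric in the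
    two factors, so each statement on left factors also applies to right
    ones. *)
Record tensor_like (K : fieldType) (A B : lmodType K) (O : zmodType) (t : A -> B -> O) :
    Prop := TensorLike {
  tensorDl : forall a a' b, t (a + a') b = t a b + t a' b;
  tensorDr : forall a b b', t a (b + b') = t a b + t a b';
  tensorZ : forall c a b, t (c *: a) b = t a (c *: b);
  tensor_eq0 : forall a b, t a b = 0 -> a = 0 \/ b = 0;
  tensor_sum : forall a b a' b' a'' b'', t a b + t a' b' = t a'' b'' ->
    parallel a a' \/ parallel b b' }.

Definition tswap (A B O : Type) (t : A -> B -> O) := fun b a => t a b.

Section TensorTheory.
Context (K : fieldType) (A B : lmodType K) (O : zmodType) (t : A -> B -> O).
Hypothesis tt : tensor_like t.

Lemma tensor_swap : tensor_like (tswap t).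
Proof.
case: tt => Dl Dr Z z s; split=> //.
- by move=> b b' a; exact: Dr.
- by move=> b a a'; exact: Dl.
- by move=> c b a; rewrite /tswap Z.
- by move=> b a /z [->|->]; [right|left].
- by move=> b a b' a' b'' a'' /s [?|?]; [right|left].
Qed.

Lemma tensor0r a : t a 0 = 0.
Proof.
by apply: (addIr (t a 0)); rewrite -(tensorDr tt) !add0r.
Qed.

Lemma tensor0l b : t 0 b = 0.
Proof.
by apply: (addIr (t 0 b)); rewrite -(tensorDl tt) !add0r.
Qed.

Lemma tensorNr a b : t a (- b) = - t a b.
Proof. by apply: (addIr (t a b)); rewrite -(tensorDr tt) !addNr tensor0r. Qed.

Lemma tensorNl a b : t (- a) b = - t a b.
Proof. by apply: (addIr (t a b)); rewrite -(tensorDl tt) !addNr tensor0l. Qed.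

Lemma tensor_neq0 a b : a != 0 -> b != 0 -> t a b != 0.
Proof. by move=> a0 b0; apply/eqP => /(tensor_eq0 tt)[] e; rewrite e eqxx in a0 b0. Qed.

Lemma tensor_neq0P a b : t a b != 0 -> a != 0 /\ b != 0.
Proof.
by move=> tab; split; apply/eqP => e; rewrite e ?tensor0l ?tensor0r eqxx in tab.
Qed.

Lemma tensor_cancel_r a a' b : b != 0 -> t a b = t a' b -> a = a'.
Proof.
move=> b0 tE; apply/eqP; rewrite -subr_eq0; apply/eqP.
have [//|e] : a - a' = 0 \/ b = 0; last by rewrite e eqxx in b0.
by apply: (tensor_eq0 tt); rewrite (tensorDl tt) tensorNl tE subrr.
Qed.

Lemma tensor_parallel_l a b a' b' : t a b = t a' b' -> t a b != 0 -> parallel a a'.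
Proof.
move=> tE t0; have [a0 b0] := tensor_neq0P t0.
have t0' : t a' b' != 0 by rewrite -tE.
have [a'0 b'0] := tensor_neq0P t0'.
have [//|/(parallelE b0)[c b'E]] : parallel a a' \/ parallel b (- b').
  by apply: (tensor_sum tt (a'' := 0) (b'' := 0)); rewrite tensorNr tE subrr tensor0r.
apply: parallel_sym; right; exists (- c); apply: (tensor_cancel_r b0).
by rewrite tE (tensorZ tt) scaleNr -b'E opprK.
Qed.

End TensorTheory.

Lemma tensor_cancel_l (K : fieldType) (A B : lmodType K) (O : zmodType) (t : A -> B -> O) a b b' :
  tensor_like t -> a != 0 -> t a b = t a b' -> b = b'.
Proof. move=> /tensor_swap tt; exact: (tensor_cancel_r tt). Qed.

Lemma tensor_parallel_r (K : fieldType) (A B : lmodType K) (O : zmodType) (t : A -> B -> O)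
  a b a' b' : tensor_like t -> t a b = t a' b' -> t a b != 0 -> parallel b b'.
Proof. move=> /tensor_swap tt; exact: (tensor_parallel_l tt). Qed.

(** Unless all members share their left factor, take two, [h0] and [h1], that do
    not. Their sum is elementary, so they share the right factor [b0]. Any third
    member must share a factor with both, and the left factors of [h0] and [h1]
    cannot both be parallel to its own; so its right factor is [b0] as well. *)
Lemma elementary_closed_common_factor (K : fieldType) (A B : lmodType K) (O : zmodType)
  (t : A -> B -> O) (H : O -> Prop) : tensor_like t ->
  (forall x y, H x -> H y -> H (x + y)) ->
  (forall x, H x -> exists a b, x = t a b) ->
  (exists a, forall x, H x -> exists b, x = t a b) \/
  (exists b, forall x, H x -> exists a, x = t a b).
Proof.
move=> tt HD Ht; apply: contrapT => /not_orP[nl nr].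
have [h0 [Hh0 h00]] : exists h0, H h0 /\ h0 != 0.
  apply: contrapT => nh; apply: nl; exists 0 => x Hx; exists 0; rewrite (tensor0r tt).
  by apply/eqP; apply: contrapT => /negP x0; apply: nh; exists x.
have [a0 [b0 h0E]] := Ht _ Hh0.
have [a00 b00] : a0 != 0 /\ b0 != 0 by apply: (tensor_neq0P tt); rewrite -h0E.
have [h1 [Hh1 h1n]] : exists h1, H h1 /\ forall b, h1 <> t a0 b.
  apply: contrapT => nh; apply: nl; exists a0 => x Hx.
  apply: contrapT => nb; apply: nh; exists x; split=> // b xE.
  by apply: nb; exists b.
have [a1 [b1 h1E]] := Ht _ Hh1.
have [x [y xyE]] := Ht _ (HD _ _ Hh0 Hh1).
have : parallel b0 b1.
  have [|//] := tensor_sum tt (esym (etrans (esym xyE) (congr2 +%R h0E h1E))).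
  move=> /(parallelE a00)[c a1E]; exfalso; apply: (h1n (c *: b1)).
  by rewrite h1E a1E (tensorZ tt).
move=> /(parallelE b00)[c b1E].
have {}h1E : h1 = t (c *: a1) b0 by rewrite h1E b1E (tensorZ tt).
set a2 := c *: a1 in h1E.
have a02 : ~ parallel a0 a2.
  move=> /(parallelE a00)[d a2E]; apply: (h1n (d *: b0)).
  by rewrite h1E a2E (tensorZ tt).
apply: nr; exists b0 => h Hh; have [a [b hE]] := Ht _ Hh.
have [->|hn0] := eqVneq h 0; first by exists 0; rewrite (tensor0l tt).
have [an0 bn0] : a != 0 /\ b != 0 by apply: (tensor_neq0P tt); rewrite -hE.
have [] : parallel a a0 \/ parallel b b0.
- have [p [q pq]] := Ht _ (HD _ _ Hh Hh0).
  exact: (tensor_sum tt (esym (etrans (esym pq) (congr2 +%R hE h0E)))).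
- move=> aa0.
  have [] : parallel a a2 \/ parallel b b0.
  + have [p [q pq]] := Ht _ (HD _ _ Hh Hh1).
    exact: (tensor_sum tt (esym (etrans (esym pq) (congr2 +%R hE h1E)))).
  + move=> aa2; case: a02; exact: parallel_trans an0 (parallel_sym aa0) aa2.
  by move=> /parallel_sym/(parallelE b00)[d bE]; exists (d *: a); rewrite hE bE (tensorZ tt).
by move=> /parallel_sym/(parallelE b00)[d bE]; exists (d *: a); rewrite hE bE (tensorZ tt).
Qed.

Section LeftImages.
Context (K : fieldType) (A B A' B' : lmodType K) (O O' : zmodType).
Context (t : A -> B -> O) (t' : A' -> B' -> O') (theta : O -> O').
Hypotheses (tt : tensor_like t) (tt' : tensor_like t').
Hypotheses (bigA : not_a_line A) (bigB : not_a_line B).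
Hypothesis thetaD : {morph theta : x y / x + y}.
Hypothesis theta_inj : injective theta.
Hypothesis theta_elem : forall a b, exists a' b', theta (t a b) = t' a' b'.
Hypothesis theta_onto : forall a' b', exists a b, t' a' b' = theta (t a b).

Definition left_to a a' := forall b, exists b', theta (t a b) = t' a' b'.

Lemma theta0 : theta 0 = 0.
Proof. by apply: (addIr (theta 0)); rewrite -thetaD !add0r. Qed.

Lemma theta_neq0 a b : a != 0 -> b != 0 -> theta (t a b) != 0.
Proof.
move=> a0 b0; apply/eqP; rewrite -theta0 => /theta_inj; apply/eqP.
exact: tensor_neq0.
Qed.

Lemma left_to_neq0 a a' : a != 0 -> left_to a a' -> a' != 0.
Proof.
move=> a0 aa'; have [[b b0] _] := bigB; have [b' tE] := aa' b.
by have := theta_neq0 a0 b0; rewrite tE => /(tensor_neq0P tt')[].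
Qed.

Lemma left_to_parallel a a' a'' : parallel a' a'' -> a' != 0 -> a'' != 0 -> left_to a a' ->
  left_to a a''.
Proof.
move=> /parallel_sym a'a'' a'0 a''0 aa' b; have [b' ->] := aa' b.
by have [c ->] := parallelE a''0 a'a''; exists (c *: b'); rewrite (tensorZ tt').
Qed.

Lemma left_or_right a :
  (exists a', left_to a a') \/ (exists b', forall b, exists a', theta (t a b) = t' a' b').
Proof.
have [|||[a' aa']|[b' ab']] := @elementary_closed_common_factor _ _ _ _ t'
   (fun x => exists b, x = theta (t a b)).
- exact: tt'.
- by move=> _ _ [b ->] [c ->]; exists (b + c); rewrite (tensorDr tt) thetaD.
- by move=> _ [b ->].
- by left; exists a' => b; apply: aa'; exists b.
- by right; exists b' => b; apply: ab'; exists b.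
Qed.

(** The preimage of all tensors with left factor [a'] is again a group of
    elementary tensors, hence has a common factor, which can only be [a]. *)
Lemma left_to_onto a a' : a != 0 -> left_to a a' ->
  forall b', exists b, t' a' b' = theta (t a b).
Proof.
move=> a0 aa'.
have [|||[z zP]|[f fP]] := @elementary_closed_common_factor _ _ _ _ t
   (fun x => exists b', theta x = t' a' b').
- exact: tt.
- move=> x y [b xE] [c yE]; exists (b + c); by rewrite (tensorDr tt') thetaD xE yE.
- move=> x [b' xE]; have [u [v uv]] := theta_onto a' b'.
  by exists u, v; apply: theta_inj; rewrite xE uv.
- move=> b'; have [u [v uv]] := theta_onto a' b'.
  have [w wE] : exists w, t u v = t z w by apply: zP; exists b'.
  have [[b b0] _] := bigB.
  have [b1 bE] : exists b1, t a b = t z b1 by apply: zP; exact: aa'.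
  have [c zE] := parallelE a0 (tensor_parallel_l tt bE (tensor_neq0 tt a0 b0)).
  by exists (c *: w); rewrite uv wE zE (tensorZ tt).
- exfalso; have par b : b != 0 -> parallel f b.
    move=> b0; have [a1 bE] : exists a1, t a b = t a1 f by apply: fP; exact: aa'.
    exact: parallel_sym (tensor_parallel_r tt bE (tensor_neq0 tt a0 b0)).
  have [[b b0] bP] := bigB; have [v bv] := bP b b0.
  have [_ v0] := not_parallel_neq0 bv.
  have [f0|f0] := eqVneq f 0; last first.
    by apply: bv; apply: parallel_trans f0 (parallel_sym (par b b0)) (par v v0).
  have [a1 bE] : exists a1, t a b = t a1 f by apply: fP; exact: aa'.
  by have := tensor_neq0 tt a0 b0; rewrite bE f0 (tensor0r tt) eqxx.
Qed.

Lemma left_to_inj a1 a2 a' : a1 != 0 -> a2 != 0 -> left_to a1 a' -> left_to a2 a' ->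
  parallel a1 a2.
Proof.
move=> a10 a20 l1 l2; have [[b b0] _] := bigB; have [b' bE] := l2 b.
have [c cE] := left_to_onto a10 l1 b'.
have tE : t a2 b = t a1 c by apply: theta_inj; rewrite bE cE.
exact: parallel_sym (tensor_parallel_l tt tE (tensor_neq0 tt a20 b0)).
Qed.

End LeftImages.

Section ElementaryPreservers.
Context (K : fieldType) (A B A' B' : lmodType K) (O O' : zmodType).
Context (t : A -> B -> O) (t' : A' -> B' -> O') (theta : O -> O').
Hypotheses (tt : tensor_like t) (tt' : tensor_like t').
Hypotheses (bigA : not_a_line A) (bigB : not_a_line B).
Hypothesis thetaD : {morph theta : x y / x + y}.
Hypothesis theta_inj : injective theta.
Hypothesis theta_elem : forall a b, exists a' b', theta (t a b) = t' a' b'.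
Hypothesis theta_onto : forall a' b', exists a b, t' a' b' = theta (t a b).

Let tn0 a b := theta_neq0 tt thetaD theta_inj (a := a) (b := b).

(** If one left factor were sent to a left factor and another to a right one,
    the two images would share a nonzero tensor, so that the two left factors
    would be parallel and behave alike. *)
Lemma left_to_all a0 a0' : a0 != 0 -> left_to t t' theta a0 a0' ->
  forall a, a != 0 -> exists a', left_to t t' theta a a'.
Proof.
move=> a00 l0 a an0.
have [//|[b' lb']] := left_or_right tt tt' thetaD theta_elem a.
have tt's := tensor_swap tt'.
have b'0 : b' != 0.
  by apply: (left_to_neq0 (t' := tswap t') tt tt's bigB thetaD theta_inj an0 lb').
have a0'0 := left_to_neq0 tt tt' bigB thetaD theta_inj a00 l0.
have [b bE] := left_to_onto tt tt' bigB thetaD theta_inj theta_onto a00 l0 b'.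
have so x y : exists a b, tswap t' x y = theta (t a b) by exact: theta_onto.
have [c cE] := left_to_onto (t' := tswap t') tt tt's bigB thetaD theta_inj so an0 lb' a0'.
have tE : t a0 b = t a c by apply: theta_inj; rewrite -bE -cE.
have t0 : t a0 b != 0.
  apply: contra_neq (tensor_neq0 tt' a0'0 b'0) => t0.
  by rewrite bE t0 (theta0 thetaD).
have [c' aE] := parallelE a00 (tensor_parallel_l tt tE t0).
by exists a0' => d; rewrite aE (tensorZ tt); exact: l0.
Qed.

(** Left factors going to left factors forces right factors to go to right
    factors: otherwise two independent left factors would have parallel
    images. *)
Lemma right_to_all a0 a0' : a0 != 0 -> left_to t t' theta a0 a0' ->
  forall b, b != 0 -> exists b', left_to (tswap t) (tswap t') theta b b'.
Proof.
move=> a00 l0 b b0.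
have tts := tensor_swap tt; have tt's := tensor_swap tt'.
have es x y : exists x' y', theta (tswap t x y) = tswap t' x' y'.
  by have [u [v uv]] := theta_elem y x; exists v, u.
have [//|[a' la']] := left_or_right tts tt's thetaD es b.
have par a : a != 0 -> left_to t t' theta a a'.
  move=> an0; have [p lp] := left_to_all a00 l0 an0.
  have [b1 b1E] := la' a; have [b2 b2E] := lp b.
  have tE : t' p b2 = t' a' b1 by exact: etrans (esym b2E) b1E.
  have tb := tn0 an0 b0.
  have p0 : t' p b2 != 0 by rewrite -b2E.
  have a'0 : t' a' b1 != 0 by rewrite -tE.
  apply: (left_to_parallel tt' (tensor_parallel_l tt' tE p0) _ _ lp).
    exact: (proj1 (tensor_neq0P tt' p0)).
  exact: (proj1 (tensor_neq0P tt' a'0)).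
exfalso; have [_ bP] := bigA; have [a an] := bP a0 a00.
have [_ an0] := not_parallel_neq0 an.
by apply: an; apply: (left_to_inj tt tt' bigB thetaD theta_inj theta_onto) (par _ _) (par _ _).
Qed.

(** The two additive maps are read off on the tensors with right factor [b0],
    respectively with left factor [a0]. The image of a general [t a b] then has
    factors parallel to [U a] and [W b]. Additivity in [a] shows that the
    remaining scalar is the same for independent left factors, and dimension at
    least two connects any left factor with [a0]. *)
Theorem elementary_preserver_left a0 a0' : a0 != 0 -> left_to t t' theta a0 a0' ->
  exists U W, [/\ {morph U : x y / x + y}, {morph W : x y / x + y} &
    forall a b, theta (t a b) = t' (U a) (W b)].
Proof.
move=> a00 l0.
have [[b0 b00] bigB2] := bigB; have [_ bigA2] := bigA.
have [b0' rb0] := right_to_all a00 l0 b00.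
have b0'0 : b0' != 0.
  have tts := tensor_swap tt; have tt's := tensor_swap tt'.
  exact: (left_to_neq0 tts tt's bigA thetaD theta_inj b00 rb0).
have [U UP] : exists U, forall a, theta (t a b0) = t' (U a) b0'.
  by exists (fun a => projT1 (cid (rb0 a))) => a; case: cid.
have U0 a : a != 0 -> U a != 0.
  by move=> an0; have := tn0 an0 b00; rewrite UP => /(tensor_neq0P tt')[].
have UD : {morph U : x y / x + y}.
  move=> x y; apply: (tensor_cancel_r tt' b0'0).
  by rewrite -UP (tensorDl tt) thetaD !UP (tensorDl tt').
have lU a : a != 0 -> left_to t t' theta a (U a).
  move=> an0; have [p lp] := left_to_all a00 l0 an0; have [b' b'E] := lp b0.
  have tE : t' p b' = t' (U a) b0' by rewrite -b'E UP.
  have p0 : t' p b' != 0 by rewrite -b'E; exact: tn0.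
  apply: (left_to_parallel tt' (tensor_parallel_l tt' tE p0) _ (U0 _ an0) lp).
  exact: (proj1 (tensor_neq0P tt' p0)).
have [W WP] : exists W, forall b, theta (t a0 b) = t' (U a0) (W b).
  by exists (fun b => projT1 (cid (lU a0 a00 b))) => b; case: cid.
have W0 b : b != 0 -> W b != 0.
  by move=> bn0; have := tn0 a00 bn0; rewrite WP => /(tensor_neq0P tt')[].
have WD : {morph W : x y / x + y}.
  move=> x y; apply: (tensor_cancel_l tt' (U0 _ a00)).
  by rewrite -WP (tensorDr tt) thetaD !WP (tensorDr tt').
have rW b : b != 0 -> left_to (tswap t) (tswap t') theta b (W b).
  move=> bn0; have [q rq] := right_to_all a00 l0 bn0; have [a' a'E] := rq a0.
  have tE : t' a' q = t' (U a0) (W b) by rewrite -[LHS]a'E -WP.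
  have p0 : t' a' q != 0 by rewrite -[X in X != _]a'E; exact: tn0.
  apply: (left_to_parallel (tensor_swap tt') (tensor_parallel_r tt' tE p0) _ (W0 _ bn0) rq).
  exact: (proj2 (tensor_neq0P tt' p0)).
have cE a b : a != 0 -> b != 0 -> exists c, theta (t a b) = t' (U a) (c *: W b).
  move=> an0 bn0; have [b' b'E] := lU a an0 b; have [a' a'E] := rW b bn0 a.
  have tE : t' a' (W b) = t' (U a) b' by rewrite -[LHS]a'E -b'E.
  have p0 : t' a' (W b) != 0 by rewrite -[X in X != _]a'E; exact: tn0.
  have [c b'W] := parallelE (W0 _ bn0) (tensor_parallel_r tt' tE p0).
  by exists c; rewrite b'E b'W.
have U_free a1 a2 : ~ parallel a1 a2 -> ~ parallel (U a1) (U a2).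
  move=> a12; have [a10 a20] := not_parallel_neq0 a12 => U12; apply: a12.
  apply: (left_to_inj tt tt' bigB thetaD theta_inj theta_onto a10 a20 (a' := U a2));
    last exact: lU.
  exact: (left_to_parallel tt' U12 (U0 _ a10) (U0 _ a20) (lU _ a10)).
have c_eq a1 a2 b c1 c2 : b != 0 -> ~ parallel a1 a2 ->
    theta (t a1 b) = t' (U a1) (c1 *: W b) -> theta (t a2 b) = t' (U a2) (c2 *: W b) -> c1 = c2.
  move=> bn0 a12 c1E c2E.
  have a120 : a1 + a2 != 0.
    apply/eqP => a0E; apply: a12; right; exists (-1); apply/eqP.
    by rewrite scaleN1r -addr_eq0 addrC a0E.
  have [c3 c3E] := cE _ _ a120 bn0.
  have : (c3 - c1) *: U a1 + (c3 - c2) *: U a2 = 0.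
    apply: (tensor_cancel_r tt' (W0 _ bn0)); rewrite (tensor0l tt').
    rewrite !scalerBl addrACA -opprD -scalerDr -UD.
    rewrite (tensorDl tt') (tensorNl tt') (tensorDl tt') !(tensorZ tt') -c1E -c2E -c3E.
    by rewrite -thetaD -(tensorDl tt) subrr.
  move=> /(not_parallel_free (U_free _ _ a12))[/eqP + /eqP].
  by rewrite !subr_eq0 => /eqP <- /eqP.
exists U, W; split=> // a b.
have [->|an0] := eqVneq a 0.
  have -> : U 0 = 0 by apply: (addIr (U 0)); rewrite -UD !add0r.
  by rewrite (tensor0l tt) (theta0 thetaD) (tensor0l tt').
have [->|bn0] := eqVneq b 0.
  have -> : W 0 = 0 by apply: (addIr (W 0)); rewrite -WD !add0r.
  by rewrite (tensor0r tt) (theta0 thetaD) (tensor0r tt').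
have [c abE] := cE _ _ an0 bn0.
have w1 : theta (t a0 b) = t' (U a0) (1 *: W b) by rewrite scale1r.
rewrite abE; suff -> : c = 1 by rewrite scale1r.
have [p|np] := pselect (parallel a0 a); last by apply/esym; exact: c_eq np w1 abE.
have [a2 a02] := bigA2 a0 a00; have [_ a20] := not_parallel_neq0 a02.
have [d dE] := cE _ _ a20 bn0.
have -> : c = d.
  apply: (c_eq a a2 b) => // aa2; apply: a02.
  exact: parallel_trans an0 p aa2.
by apply/esym; exact: c_eq a02 w1 dE.
Qed.

End ElementaryPreservers.

Theorem elementary_preserver (K : fieldType) (A B A' B' : lmodType K) (O O' : zmodType)
  (t : A -> B -> O) (t' : A' -> B' -> O') (theta : O -> O') :
  tensor_like t -> tensor_like t' -> not_a_line A -> not_a_line B ->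
  {morph theta : x y / x + y} -> injective theta ->
  (forall a b, exists a' b', theta (t a b) = t' a' b') ->
  (forall a' b', exists a b, t' a' b' = theta (t a b)) ->
  (exists U W, [/\ {morph U : x y / x + y}, {morph W : x y / x + y} &
    forall a b, theta (t a b) = t' (U a) (W b)]) \/
  (exists U W, [/\ {morph U : x y / x + y}, {morph W : x y / x + y} &
    forall a b, theta (t a b) = t' (W b) (U a)]).
Proof.
move=> tt tt' bigA bigB thetaD inj elem onto.
have [[a0 a00] _] := bigA.
have [[a' la]|[b' lb]] := left_or_right tt tt' thetaD elem a0.
  by left; apply: (elementary_preserver_left tt tt' bigA bigB thetaD inj elem onto a00 la).
right; apply: (elementary_preserver_left (t' := tswap t') tt (tensor_swap tt')
  bigA bigB thetaD inj _ _ a00 lb).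
  by move=> a b; have [u [v uv]] := elem a b; exists v, u.
by move=> u v; exact: onto.
Qed.

(** * From additive to semilinear *)

Section Rank1Tensor.
Context (R : realType) (X Y : normedModType R[i]).

Lemma functional_kernel (f g : dual X) : ~ parallel f g -> exists z, f z = 0 /\ g z != 0.
Proof.
move=> fg; apply: contrapT => nz; have [f0 _] := not_parallel_neq0 fg.
have ker z : f z = 0 -> g z = 0.
  by move=> fz; apply/eqP; apply: contrapT => /negP gz; apply: nz; exists z.
have [u fu] : exists u, f u != 0.
  apply: contrapT => nu; move/eqP: f0; apply; apply: bop_ext => z.
  by apply/eqP; apply: contrapT => /negP fz; apply: nu; exists z.
apply: fg; right; exists (g u / f u); apply: bop_ext => z.
have := ker (z - (f z / f u) *: u); rewrite !bop_sub !dual_scale divfK// subrr.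
move=> /(_ erefl)/eqP; rewrite subr_eq0 => /eqP ->.
by rewrite bopZE /GRing.scale /=; ring.
Qed.

(** If [f] and [f'] are independent, evaluating at a zero of one of them that
    is not a zero of the other puts both [x] and [x'] on the line of [x'']. *)
Lemma rank1_tensor_like : tensor_like (@rank1 R X Y).
Proof.
split.
- by move=> x x' f; exact: rank1Dl.
- by move=> x f f'; exact: rank1Dr.
- by move=> c x f; exact: rank1Z.
- by move=> x f; exact: rank1_eq0.
move=> x f x' f' x'' f'' sumE.
have val z : f z *: x + f' z *: x' = f'' z *: x''.
  by have /(congr1 (fun T : bop X Y => T z)) := sumE.
have [|npar] := pselect (parallel f f'); [by right|left].
have [z [fz f'z]] := functional_kernel npar.
have [z' [f'z' fz']] := functional_kernel (fun p => npar (parallel_sym p)).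
have x'E : x' = ((f' z)^-1 * f'' z) *: x''.
  by rewrite -scalerA -val fz scale0r add0r scalerA mulVf// scale1r.
have xE : x = ((f z')^-1 * f'' z') *: x''.
  by rewrite -scalerA -val f'z' scale0r addr0 scalerA mulVf// scale1r.
have [->|x0] := eqVneq x 0; first by left.
have x''0 : x'' != 0 by apply: contra_neq x0 => e; rewrite xE e scaler0.
apply: (parallel_trans x''0); last by right; eexists; exact: x'E.
by apply: parallel_sym; right; eexists; exact: xE.
Qed.

End Rank1Tensor.

Section Semilinear.
Context (R : realType).
Implicit Types (b : bool) (c : R[i]).

(** The boolean distinguishes the conjugate linear from the linear case, so that
    one proof covers both. *)
Definition twist b c : R[i] := if b then c^*%C else c.

Definition semilinear b (E F : normedModType R[i]) (U : E -> F) :=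
  {morph U : x y / x + y} /\ forall c x, U (c *: x) = twist b c *: U x.

Lemma twistK b c : twist b (twist b c) = c.
Proof. by case: b => //=; case: c => x y /=; rewrite opprK. Qed.

Lemma twist0 b : twist b 0 = 0.
Proof. by case: b => //=; rewrite oppr0. Qed.

Lemma twistN1 b : twist b (-1) = -1.
Proof. by case: b => //=; apply/eqP; rewrite eq_complex /= oppr0 oppr0 !eqxx. Qed.

Lemma twistM b c d : twist b (c * d) = twist b c * twist b d.
Proof. by case: b => //=; exact: rmorphM. Qed.

Lemma cabs_twist b c : cabs (twist b c) = cabs c.
Proof. by case: b => //=; exact: cabs_conj. Qed.

Lemma semilinear0 b (E F : normedModType R[i]) (U : E -> F) : semilinear b U -> U 0 = 0.
Proof. by move=> [_ UZ]; rewrite -(scale0r 0) UZ twist0 scale0r. Qed.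

Lemma semilinearB b (E F : normedModType R[i]) (U : E -> F) x y :
  semilinear b U -> U (x - y) = U x - U y.
Proof.
by move=> [UD UZ]; rewrite UD -[- y]scaleN1r UZ twistN1 scaleN1r.
Qed.

(** The distances of [c] to [0], [1] and ['i] determine [c], and [tau] preserves
    them, up to the choice of [tau 'i] among ['i] and its opposite. *)
Lemma additive_isometry_twist (tau : R[i] -> R[i]) : {morph tau : x y / x + y} ->
  tau 1 = 1 -> (forall c, cabs (tau c) = cabs c) -> exists b, tau =1 twist b.
Proof.
move=> tauD tau1 tau_abs.
have tauN c : tau (- c) = - tau c.
  have tau0 : tau 0 = 0 by apply: (addIr (tau 0)); rewrite -tauD !add0r.
  by apply: (addIr (tau c)); rewrite -tauD !addNr.
have sq c d : (Re (tau c) + Re (tau d)) ^+ 2 + (Im (tau c) + Im (tau d)) ^+ 2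
    = (Re c + Re d) ^+ 2 + (Im c + Im d) ^+ 2.
  have := tau_abs (c + d); rewrite tauD => /(congr1 (fun x => x ^+ 2)).
  by rewrite !cabs_sqr; move: (tau c) (tau d) => [? ?] [? ?]; move: c d => [? ?] [? ?].
have sq1 c : Re (tau c) ^+ 2 + Im (tau c) ^+ 2 = Re c ^+ 2 + Im c ^+ 2.
  by rewrite -!cabs_sqr tau_abs.
have tauRe c : Re (tau c) = Re c.
  have := sq c 1; rewrite tau1 /= !addr0; have := sq1 c.
  by move=> h1 h2; lra.
have tauIm c : Im (tau 'i) * Im (tau c) = Im c.
  have := sq c 'i; have := sq1 c; have := sq1 'i; rewrite !tauRe /= => h1 h2 h3; lra.
have := tauIm 'i => /=; rewrite -expr2 => /eqP; rewrite sqrf_eq1 => /orP[] /eqP ti.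
  exists false => c; apply/eqP; rewrite eq_complex tauRe eqxx /=.
  by have := tauIm c; rewrite ti mul1r => ->.
exists true => c; apply/eqP; have := tauRe c; have := tauIm c; rewrite ti.
case: (tau c) => x y; case: c => x' y' /= <- ->.
by rewrite eq_complex /= eqxx mulN1r opprK eqxx.
Qed.

End Semilinear.

Section Normalization.
Context (R : realType) (E F X Y : normedModType R[i]) (U0 : E -> Y) (W0 : F -> dual X).
Hypotheses (U0D : {morph U0 : x y / x + y}) (W0D : {morph W0 : x y / x + y}).
Hypothesis balanced : forall c e f, rank1 (U0 (c *: e)) (W0 f) = rank1 (U0 e) (W0 (c *: f)).
Hypothesis norm_eq : forall e f, rnorm (U0 e) * rnorm (W0 f) = rnorm e * rnorm f.
Hypotheses (E0 : exists e : E, e != 0) (F0 : exists f : F, f != 0).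

(** The homogeneity defect [tau] of [U0] is shared by [W0], and it is an
    isometry once the norms have been distributed evenly. *)
Lemma normalize_factors : exists b (U : E -> Y) (W : F -> dual X),
  [/\ semilinear b U, semilinear b W, forall e, rnorm (U e) = rnorm e,
      forall f, rnorm (W f) = rnorm f & forall e f, rank1 (U e) (W f) = rank1 (U0 e) (W0 f)].
Proof.
have [e0 e00] := E0; have [f0 f00] := F0.
have tt := @rank1_tensor_like R X Y.
(* multiplying [U0] by [k] and dividing [W0] by [k] makes both isometric *)
pose k := rnorm (W0 f0) / rnorm f0.
have Ue0 : rnorm (U0 e0) != 0.
  apply/eqP => u0; have := norm_eq e0 f0; rewrite u0 mul0r => /esym/eqP.
  by rewrite mulf_eq0 !gt_eqF ?rn_gt0.
have Wf0 : rnorm (W0 f0) != 0.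
  apply/eqP => u0; have := norm_eq e0 f0; rewrite u0 mulr0 => /esym/eqP.
  by rewrite mulf_eq0 !gt_eqF ?rn_gt0.
have nf0 : rnorm f0 != 0 by rewrite gt_eqF ?rn_gt0.
have k0 : k != 0 by rewrite mulf_neq0// invr_eq0.
have kge0 : 0 <= k by rewrite divr_ge0 ?rnorm_ge0.
have kC0 : k%:C != 0 :> R[i] by apply/eqP => /complexI/eqP; rewrite (negbTE k0).
pose U e := k%:C *: U0 e; pose W f := (k%:C)^-1 *: W0 f.
have UWE e f : rank1 (U e) (W f) = rank1 (U0 e) (W0 f).
  by rewrite rank1Z scalerA mulfV// scale1r.
have UD : {morph U : x y / x + y} by move=> x y; rewrite /U U0D scalerDr.
have WD : {morph W : x y / x + y} by move=> x y; rewrite /W W0D scalerDr.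
have nU e : rnorm (U e) = rnorm e.
  by rewrite rnZr// /k mulrAC [X in X / _]mulrC norm_eq mulfK.
have nW f : rnorm (W f) = rnorm f.
  have ke0 : k * rnorm (U0 e0) = rnorm e0 by rewrite -(nU e0) rnZr.
  rewrite rnZ cabsV cabs_pos//; apply: (mulfI Ue0); apply: (mulfI k0).
  by rewrite [RHS]mulrA ke0 -norm_eq; field.
have bal c e f : rank1 (U (c *: e)) (W f) = rank1 (U e) (W (c *: f)).
  by rewrite !UWE.
have Un0 e : e != 0 -> U e != 0.
  by move=> en0; apply/eqP => u0; have := rn_gt0 en0; rewrite -nU u0 rnorm0 ltxx.
have Wn0 f : f != 0 -> W f != 0.
  by move=> fn0; apply/eqP => u0; have := rn_gt0 fn0; rewrite -nW u0 rnorm0 ltxx.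
have tau_ex c : exists d, W (c *: f0) = d *: W f0.
  have [->|c0] := eqVneq c 0.
    by exists 0; rewrite !scale0r; apply: rnorm_eq0; rewrite nW rnorm0.
  apply: (parallelE (Wn0 _ f00)).
  have cE := bal c e0 f0.
  apply: (tensor_parallel_r tt cE).
  by apply: (tensor_neq0 tt); [apply: Un0; rewrite scaler_eq0 negb_or c0|exact: Wn0].
pose tau c := projT1 (cid (tau_ex c)).
have tauE c : W (c *: f0) = tau c *: W f0 by rewrite /tau; case: cid.
have UZ c e : U (c *: e) = tau c *: U e.
  by apply: (tensor_cancel_r tt (Wn0 _ f00)); rewrite bal tauE [RHS]rank1Z.
have WZ c f : W (c *: f) = tau c *: W f.
  by apply: (tensor_cancel_l tt (Un0 _ e00)); rewrite -bal UZ [LHS]rank1Z.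
have Uinj c d : c *: U e0 = d *: U e0 -> c = d.
  move=> cd; apply/eqP; rewrite -subr_eq0; have := Un0 _ e00; apply: contraNT => cd0.
  have : (c - d) *: U e0 == 0 by rewrite scalerBl cd subrr.
  by rewrite scaler_eq0 (negbTE cd0).
have [||c|b bP] := @additive_isometry_twist R tau.
- by move=> c d; apply: Uinj; rewrite -UZ !scalerDl UD !UZ.
- by apply: Uinj; rewrite -UZ !scale1r.
- have : rnorm (U (c *: e0)) = rnorm (c *: e0) by exact: nU.
  rewrite UZ (rnZ (tau c) (U e0)) nU rnZ => /mulIf; apply; rewrite gt_eqF ?rn_gt0 //.
exists b, U, W; split=> //; split=> // c x.
  by rewrite UZ bP.
by rewrite WZ bP.
Qed.

End Normalization.

Lemma factors_surjective (R : realType) (E F X Y : normedModType R[i]) b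
  (U : E -> Y) (W : F -> dual X) :
  semilinear b U -> semilinear b W ->
  (forall y g, exists e f, rank1 y g = rank1 (U e) (W f)) ->
  (exists y : Y, y != 0) -> (exists g : dual X, g != 0) ->
  (forall y, exists e, U e = y) /\ (forall g, exists f, W f = g).
Proof.
move=> lU lW onto [y1 y10] [g1 g10]; have tt := @rank1_tensor_like R X Y.
split=> [y|g].
  have [->|y0] := eqVneq y 0; first by exists 0; exact: semilinear0 lU.
  have [e [f ef]] := onto y g1; have yg0 := tensor_neq0 tt y0 g10.
  have [c yE] : exists c, y = c *: U e.
    apply: parallelE; last exact: (parallel_sym (tensor_parallel_l tt ef yg0)).
    by apply: (proj1 (tensor_neq0P tt (a := U e) (b := W f) _)); rewrite -ef.
  by exists (twist b c *: e); rewrite (proj2 lU) twistK.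
have [->|g0] := eqVneq g 0; first by exists 0; exact: semilinear0 lW.
have [e [f ef]] := onto y1 g; have yg0 := tensor_neq0 tt y10 g0.
have [c gE] : exists c, g = c *: W f.
  apply: parallelE; last exact: (parallel_sym (tensor_parallel_r tt ef yg0)).
  by apply: (proj2 (tensor_neq0P tt (a := U e) (b := W f) _)); rewrite -ef.
by exists (twist b c *: f); rewrite (proj2 lW) twistK.
Qed.

(** * Reconstruction of the map from its values on rank one operators *)

(** The space [E] is [X] or its dual, [F] is the other one, [beta] is the
    duality pairing and [act T] is [T] or its adjoint. The hypothesis
    [bad_iff] is the description of bad rank one perturbations of an
    invertible [T]; since semi-invertibility is preserved, it can be read in
    [Y], where it determines [phi T]. *)
Section Reconstruction.
Context (R : realType) (X Y : completeNormedModType R[i]) (E F : normedModType R[i]).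
Context (beta : E -> F -> R[i]) (r : E -> F -> bop X X) (act : bop X X -> E -> E).
Context (phi : bop X X -> bop Y Y) (b : bool) (U : E -> Y) (W : F -> dual Y).
Hypotheses (betaZ : forall c e f, beta e (c *: f) = c * beta e f)
  (betaZl : forall c e f, beta (c *: e) f = c * beta e f)
  (beta_le : forall e f, cabs (beta e f) <= rnorm e * rnorm f)
  (beta_norming : forall e M, 0 <= M -> (forall f, cabs (beta e f) <= M * rnorm f) -> rnorm e <= M)
  (beta_nondeg : forall f, f != 0 -> exists e, beta e f != 0).
Hypotheses (act_id : forall e, act (bop_id X) e = e)
  (actB : forall S T e, act (S - T) e = act S e - act T e)
  (act0 : forall T, act T 0 = 0)
  (act_surj : forall T, invertible T -> forall e, exists e', act T e' = e).
Hypothesis bad_iff : forall T e f, invertible T ->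
  ~ semi_invertible (T + r (act T e) f) <-> beta e f = -1.
Hypotheses (phiD : {morph phi : S T / S + T})
  (phi_semi : forall T, semi_invertible (phi T) <-> semi_invertible T)
  (phi_r : forall e f, phi (r e f) = rank1 (U e) (W f)).
Hypotheses (lU : semilinear b U) (lW : semilinear b W)
  (nU : forall e, rnorm (U e) = rnorm e) (nW : forall f, rnorm (W f) = rnorm f)
  (sU : forall y, exists e, U e = y) (sW : forall g, exists f, W f = g).

Let phi_bad T e f : invertible T ->
  ~ semi_invertible (phi T + rank1 (U (act T e)) (W f)) <-> beta e f = -1.
Proof.
by move=> iT; rewrite -(bad_iff _ _ iT) -phi_r -phiD phi_semi.
Qed.

Let beta_ex e : e != 0 -> exists f, beta e f = -1.
Proof.
move=> e0; have [f ef] : exists f, beta e f != 0.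
  apply: contrapT => nf; have := rn_gt0 e0; rewrite ltNge; apply/negP/negPn.
  apply: beta_norming => // f; rewrite mul0r.
  have [->|ef] := eqVneq (beta e f) 0; first by rewrite cabs0.
  by exfalso; apply: nf; exists f.
by exists (- (beta e f)^-1 *: f); rewrite betaZ mulNr mulVf.
Qed.

(** Every nonzero vector occurs as [U (act T e)] in some bad perturbation, and the
    vectors occurring there lie in the range of [phi T]. *)
Let phi_surj T y : invertible T -> exists u, phi T u = y.
Proof.
move=> iT; have [->|y0] := eqVneq y 0; first by exists 0; rewrite bop_zero.
have [e eE] := sU y; have [e' e'E] := act_surj iT e.
have e'0 : e' != 0.
  by apply: contra_neq y0 => e'0; rewrite -eE -e'E e'0 act0 (semilinear0 lU).
have [f ef] := beta_ex e'0.
have sT : semi_invertible (phi T) by apply/phi_semi/invertible_semi.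
have [u [uE _ _]] := rank1_perturb_badP sT (iffRL (phi_bad _ _ iT) ef).
by exists u; rewrite uE e'E eE.
Qed.

(** Likewise every nonzero functional occurs as [W f] in some bad perturbation,
    so all functionals vanish on the kernel of [phi T]. *)
Let phi_kernel T k : invertible T -> phi T k = 0 -> k = 0.
Proof.
move=> iT k0; apply: dual_separates => g; have [f <-] := sW g.
have [->|f0] := eqVneq f 0; first by rewrite (semilinear0 lW).
have [e ef] := beta_nondeg f0.
have ef1 : beta (- (beta e f)^-1 *: e) f = -1 by rewrite betaZl mulNr mulVf.
have sT : semi_invertible (phi T) by apply/phi_semi/invertible_semi.
have [u [_ _ kP]] := rank1_perturb_badP sT (iffRL (phi_bad _ _ iT) ef1).
exact: kP.
Qed.

Let phi_inj T y z : invertible T -> phi T y = phi T z -> y = z.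
Proof.
move=> iT yz; apply/eqP; rewrite -subr_eq0; apply/eqP; apply: (phi_kernel iT).
by rewrite bop_sub yz subrr.
Qed.

(** Rescaling [f] reduces to the value [-1]. The value [0] is recovered
    indirectly: a nonzero [W f y] could be rescaled to [-1] on the side of
    [phi T], which would produce a bad perturbation of [T]. *)
Let beta_transfer T y e f : invertible T -> phi T y = U (act T e) ->
  W f y = twist b (beta e f).
Proof.
move=> iT yE; have sT : semi_invertible (phi T) by apply/phi_semi/invertible_semi.
have [ef|ef] := eqVneq (beta e f) 0; last first.
  have ef1 : beta e (- (beta e f)^-1 *: f) = -1 by rewrite betaZ mulNr mulVf.
  have [u [uE Wu _]] := rank1_perturb_badP sT (iffRL (phi_bad _ _ iT) ef1).
  have uy : u = y by apply: (phi_inj iT); rewrite uE yE.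
  move: Wu; rewrite uy (proj2 lW) bopZE /GRing.scale /= => Wy.
  have : twist b (beta e f) * twist b (- (beta e f)^-1) = -1.
    by rewrite -twistM mulrN mulfV// twistN1.
  move=> tE; apply: (@mulfI _ (twist b (- (beta e f)^-1))).
    apply/eqP => t0; move/eqP: tE; rewrite t0 mulr0 eq_sym oppr_eq0.
    by rewrite oner_eq0.
  by rewrite Wy mulrC tE.
rewrite ef twist0; apply/eqP; apply: contrapT => /negP Wy.
pose f1 := twist b (- (W f y)^-1) *: f.
have Wf1 : W f1 y = -1 by rewrite (proj2 lW) twistK bopZE /GRing.scale /= mulNr mulVf.
have : beta e f1 = -1.
  apply/(phi_bad _ _ iT); apply: (rank1_perturb_bad yE Wf1) => k k0.
  by rewrite (phi_kernel iT k0) bop_zero.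
move/eqP; rewrite betaZ ef mulr0 eq_sym oppr_eq0 oner_eq0.
by [].
Qed.

Theorem reconstruction : exists V : Y -> E,
  [/\ semilinear b V, forall y, rnorm (V y) = rnorm y, forall e, exists y, V y = e &
      forall T y, phi T y = U (act T (V y))].
Proof.
pose S0 := phi (bop_id X); have i0 : invertible (bop_id X) by exact: invertible_id.
have [V VP] : exists V : Y -> E, forall y, U (V y) = S0 y.
  by exists (fun y => projT1 (cid (sU (S0 y)))) => y; case: cid.
have Uinj x y : U x = U y -> x = y.
  move=> xy; apply/eqP; rewrite -subr_eq0; apply/eqP/rnorm_eq0.
  by rewrite -nU (semilinearB _ _ lU) xy subrr rnorm0.
have WV y f : W f y = twist b (beta (V y) f).
  by apply: (beta_transfer f i0); rewrite act_id VP.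
exists V; split.
- split=> [x y|c y]; apply: Uinj.
    by rewrite (proj1 lU) !VP bop_add.
  by rewrite (proj2 lU) twistK !VP bop_scale.
- move=> y; apply/eqP; rewrite eq_le; apply/andP; split.
    apply: beta_norming; first exact: rnorm_ge0.
    move=> f; rewrite -(cabs_twist b) -WV -nW mulrC.
    exact: dual_le.
  have [g g1 gy] := norming_functional y; have [f fg] := sW g.
  have -> : rnorm y = cabs (g y) by rewrite gy cabs_pos// rnorm_ge0.
  rewrite -fg WV cabs_twist; apply: le_trans (beta_le _ _) _.
  by rewrite -nW fg ler_piMr ?rnorm_ge0.
- by move=> e; have [y yE] := phi_surj (U e) i0; exists y; apply: Uinj; rewrite VP.
have inv_case T y : invertible T -> phi T y = U (act T (V y)).
  move=> iT; have [z zE] := phi_surj (U (act T (V y))) iT.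
  suff yz : y = z by rewrite {1}yz.
  apply/eqP; rewrite -subr_eq0; apply/eqP; apply: dual_separates => g.
  have [f <-] := sW g; rewrite bop_sub (beta_transfer f iT zE) WV.
  by rewrite subrr.
move=> T y.
have [r1 r10 i1] := invertible_large T i0; have [r2 r20 i2] := invertible_large 0 i0.
pose c : R[i] := (r1 + r2)%:C.
have iT : invertible (c *: bop_id X + T) by apply: i1; rewrite lerDl ltW.
have {i2} iI : invertible (c *: bop_id X).
  by rewrite -[_ *: _]addr0; apply: i2; rewrite lerDr ltW.
have phiB S S' : phi (S - S') = phi S - phi S'.
  by apply/eqP; rewrite eq_sym subr_eq -phiD subrK.
have TE : T = (c *: bop_id X + T) - c *: bop_id X by rewrite addrAC subrr add0r.
rewrite TE phiB bopBE (inv_case _ _ iT) (inv_case _ _ iI) actB (semilinearB _ _ lU).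
by [].
Qed.

End Reconstruction.

(** * Additive maps preserving the reduced minimum modulus *)

(** The distance of [z] to the kernel is at least [rnorm (T z) / rnorm T]. *)
Lemma gamma_pinfty (R : realType) (X Y : normedModType R[i]) (T : bop X Y) :
  red_min_modulus T = +oo%E -> T = 0.
Proof.
move=> Too; apply: contrapT => /eqP T0; have [z Tz] : exists z, T z != 0.
  apply: contrapT => nz; move/eqP: T0; apply; apply: bop_ext => z.
  by apply/eqP; apply: contrapT => /negP Tz; apply: nz; exists z.
have Tn : 0 < rnorm T by apply: rn_gt0.
have cTz (c : R) : 0 <= c -> c * (rnorm (T z) / rnorm T) <= rnorm (T z).
  move=> c0; have cT : (c%:E <= red_min_modulus T)%E by rewrite Too leey.
  apply: le_trans (gamma_bound z c0 cT); rewrite ler_wpM2l//.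
  apply: (dist_ge (kernel0 T)) => v Tv; rewrite ler_pdivrMr// mulrC.
  by rewrite -[T z]subr0 -Tv -bop_sub bop_le.
have := cTz (2 * rnorm T); rewrite mulr_ge0 ?rnorm_ge0// => /(_ isT).
have -> : 2 * rnorm T * (rnorm (T z) / rnorm T) = 2 * rnorm (T z).
  by field; rewrite gt_eqF.
by have := rn_gt0 Tz; lra.
Qed.

Section Preserver.
Context (R : realType) (X Y : completeNormedModType R[i]).
Context (phi : bop X X -> bop Y Y).
Hypotheses (phiD : {morph phi : S T / S + T})
  (phi_surj : forall S, exists T, phi T = S)
  (phi_gamma : forall T, red_min_modulus (phi T) = red_min_modulus T).

Let phi0 : phi 0 = 0.
Proof. by apply: (addIr (phi 0)); rewrite -phiD !add0r. Qed.

Let phiMn T n : phi (T *+ n) = phi T *+ n.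
Proof. by elim: n => [|n IH]; rewrite ?mulr0n// !mulrSr phiD IH. Qed.

Lemma preserver_inj : injective phi.
Proof.
move=> S T ST; apply/eqP; rewrite -subr_eq0; apply/eqP/gamma_pinfty.
rewrite -phi_gamma; have -> : phi (S - T) = 0.
  by apply: (addIr (phi T)); rewrite -phiD subrK add0r.
by rewrite /red_min_modulus eqxx.
Qed.

Lemma preserver_semi T : semi_invertible (phi T) <-> semi_invertible T.
Proof.
rewrite -!perturbation_stableP; split=> sT S.
  have [c c0 [N NP]] := sT (phi S); exists c => //; exists N => n Nn S' S'S.
  by rewrite -phi_gamma phiD; apply: NP Nn _ _; rewrite -phiMn S'S.
have [S1 <-] := phi_surj S; have [c c0 [N NP]] := sT S1.
exists c => //; exists N => n Nn S'; have [S1' <-] := phi_surj S'.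
by rewrite -phiMn => /preserver_inj S1S; rewrite -phiD phi_gamma; exact: NP Nn _ S1S.
Qed.

Lemma preserver_rank_le1 A : rank_le1 (phi A) <-> rank_le1 A.
Proof.
split=> [] [x [f AE]]; apply: semi_alternative_rank_le1 => T.
  move=> /preserver_semi /(rank1_semi_alternative x f); rewrite -AE -!phiD.
  by rewrite !preserver_semi.
have [S <-] := phi_surj T; move=> /preserver_semi /(rank1_semi_alternative x f).
by rewrite -AE -!phiD !preserver_semi.
Qed.

Lemma preserver_rank1_norm x f y g : phi (rank1 x f) = rank1 y g ->
  rnorm y * rnorm g = rnorm x * rnorm f.
Proof.
move=> xy; have [x0|x0] := eqVneq (rank1 x f) 0.
  have y0 : rank1 y g = 0 by rewrite -xy x0 phi0.
  have z0 (V : normedModType R[i]) (v : V) (h : dual V) :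
      rank1 v h = 0 -> rnorm v * rnorm h = 0.
    by move=> /rank1_eq0[] ->; rewrite rnorm0 ?mul0r ?mulr0.
  by rewrite !z0.
have y0 : rank1 y g != 0.
  by apply: contra_neq x0 => y0; apply: preserver_inj; rewrite xy y0 phi0.
by have := phi_gamma (rank1 x f); rewrite xy !rank1_gamma// => -[].
Qed.

End Preserver.

Section StandardFormsOf.
Context (R : realType).

Lemma surj_inj_bij (A B : Type) (f : A -> B) : injective f -> (forall y, exists x, f x = y) ->
  bijective f.
Proof.
move=> inj surj; have [g gP] : exists g, cancel g f.
  by exists (fun y => projT1 (cid (surj y))) => y; case: cid.
by exists g => // x; apply: inj; rewrite gP.
Qed.

Lemma semilinear_bijective_isometry b (E F : normedModType R[i]) (U : E -> F) :
  semilinear b U -> (forall e, rnorm (U e) = rnorm e) -> (forall y, exists e, U e = y) ->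
  bijective_isometry U.
Proof.
move=> lU nU sU; split; last first.
  by move=> x y; rewrite -(semilinearB _ _ lU) -!rnormE nU.
apply: surj_inj_bij sU => x y xy; apply/eqP; rewrite -subr_eq0; apply/eqP/rnorm_eq0.
by rewrite -nU (semilinearB _ _ lU) xy subrr rnorm0.
Qed.

Lemma semilinear_cases (E F E' F' : normedModType R[i]) (U : E -> F) (V : E' -> F') :
  (linear U /\ linear V) \/ (conjugate_linear U /\ conjugate_linear V) <->
  exists b, semilinear b U /\ semilinear b V.
Proof.
have lin (A B : normedModType R[i]) (f : A -> B) : linear f <-> semilinear false f.
  split=> [lf|[fD fZ] c x y]; last by rewrite fD fZ.
  have fD : {morph f : x y / x + y}.
    by move=> x y; have := lf 1 x y; rewrite !scale1r.
  have f0 : f 0 = 0 by apply: (addIr (f 0)); rewrite -fD !add0r.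
  by split=> // c x; have := lf c x 0; rewrite !addr0 f0 addr0.
split=> [[[/lin lU /lin lV]|[lU lV]]|[[] [lU lV]]].
- by exists false.
- by exists true.
- by right.
- by left; split; apply/lin.
Qed.

End StandardFormsOf.

Section Forward.
Context (R : realType) (X Y : completeNormedModType R[i]).
Context (hX : infinite_dimensional X).

Lemma infinite_dimensional_not_a_line : not_a_line X.
Proof.
split.
  apply: contrapT => nx; apply: (hX (n := 0) (e := fun _ => 0)) => x.
  exists (fun _ => 0); rewrite big_ord0; apply/eqP; apply: contrapT => /negP x0.
  by apply: nx; exists x.
move=> u u0; apply: contrapT => nv; apply: (hX (n := 1) (e := fun _ => u)) => x.
have [[ux|[c xE]]|np] := pselect (parallel u x).
- by rewrite ux eqxx in u0.
- by exists (fun _ => c); rewrite big_ord_recl big_ord0 addr0.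
- by exfalso; apply: nv; exists x.
Qed.

Lemma dual_not_a_line : not_a_line (dual X).
Proof.
have [[x x0] xP] := infinite_dimensional_not_a_line.
split.
  have [f fx] := functional_one x0; exists f; apply/eqP => f0.
  by move/eqP: fx; rewrite f0 bop0E eq_sym oner_eq0.
move=> f f0; have [u fu] : exists u, f u != 0.
  apply: contrapT => nu; move/eqP: f0; apply; apply: bop_ext => z.
  by apply/eqP; apply: contrapT => /negP fz; apply: nu; exists z.
have u0 : u != 0 by apply: contra_neq fu => ->; rewrite bop_zero.
have [v uv] := xP u u0; pose w := v - (f v / f u) *: u.
have fw : f w = 0 by rewrite bop_sub dual_scale divfK// subrr.
have w0 : w != 0.
  apply/eqP => /eqP; rewrite subr_eq0 => /eqP vE; apply: uv; right.
  by eexists; exact: vE.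
have [g gw] := functional_one w0; exists g => /(parallelE f0)[c gE].
by move/eqP: gw; rewrite gE bopZE fw scaler0 eq_sym oner_eq0.
Qed.

Context (phi : bop X X -> bop Y Y).
Hypotheses (phiD : {morph phi : S T / S + T})
  (phi_surj : forall S, exists T, phi T = S)
  (phi_gamma : forall T, red_min_modulus (phi T) = red_min_modulus T).

(** A preimage of [f] is [f] composed with the inverse of [T]. *)
Lemma invertible_adjoint_surj (T : bop X X) : invertible T ->
  forall f : dual X, exists g, adjoint T g = f.
Proof.
move=> iT f; have [C C0 [Tb _]] := iT.
have [h hP] : exists h : X -> X, forall y, T (h y) = y.
  have ex y := invertible_surj y iT.
  by exists (fun y => projT1 (cid (ex y))) => y; case: cid.
have bl : is_bounded_linear (fun y => f (h y) : R[i]^o).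
  split=> [a y z|].
    have -> : h (a *: y + z) = a *: h y + h z.
      by apply: (below_inj Tb); rewrite bop_add bop_scale !hP.
    by rewrite bop_add bop_scale.
  exists (rnorm f * C) => y; apply: le_trans (dual_le _ _) _.
  by rewrite -mulrA ler_wpM2l ?rnorm_ge0// -{2}[y]hP.
exists (mkbop bl); apply: bop_ext => z; rewrite adjointE /=; congr (f _).
by apply: (below_inj Tb); rewrite hP.
Qed.

Lemma rank1_bad_direct (T : bop X X) x (f : dual X) : invertible T ->
  ~ semi_invertible (T + rank1 (T x) f) <-> f x = -1.
Proof.
move=> iT; split=> [bad|fx].
  have [u [Tu fu _]] := rank1_perturb_badP (invertible_semi iT) bad.
  suff -> : x = u by [].
  by case: iT => C _ [Tb _]; exact: (below_inj Tb).
apply: (rank1_perturb_bad (u := x)) => // k k0.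
by rewrite (invertible_inj iT k0) bop_zero.
Qed.

Lemma rank1_bad_adjoint (T : bop X X) x (f : dual X) : invertible T ->
  ~ semi_invertible (T + rank1 x (adjoint T f)) <-> f x = -1.
Proof.
move=> iT; split=> [bad|fx].
  have [u [Tu fu _]] := rank1_perturb_badP (invertible_semi iT) bad.
  by rewrite -Tu -adjointE.
have [u Tu] := invertible_surj x iT.
apply: (rank1_perturb_bad (u := u)) => //; first by rewrite adjointE Tu.
by move=> k k0; rewrite adjointE k0 bop_zero.
Qed.

Lemma preserver_standard_form : direct_form phi \/ adjoint_form phi.
Proof.
have inj := preserver_inj phiD phi_gamma.
have semi := preserver_semi phiD phi_surj phi_gamma.
have rk := preserver_rank_le1 phiD phi_surj phi_gamma.
have rkn := preserver_rank1_norm phiD phi_gamma.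
have bigX := infinite_dimensional_not_a_line; have bigX' := dual_not_a_line.
have onto y g : exists x f, rank1 y g = phi (rank1 x f).
  have [A AE] := phi_surj (rank1 y g).
  have /rk[x [f Axf]] : rank_le1 (phi A) by exists y, g.
  by exists x, f; rewrite -AE Axf.
have elem x f : exists y g, phi (rank1 x f) = rank1 y g by apply/rk; exists x, f.
have ttX := @rank1_tensor_like R X X; have ttY := @rank1_tensor_like R Y Y.
have [y0 [g0 [y00 g00]]] : exists (y : Y) (g : dual Y), y != 0 /\ g != 0.
  have [[x x0] _] := bigX; have [[f f0] _] := bigX'.
  have [y [g yg]] := elem x f; exists y, g.
  apply: (tensor_neq0P ttY); rewrite -yg; apply/eqP => e.
  have : rank1 x f = 0.
    by apply: inj; rewrite e; apply: (addIr (phi 0)); rewrite -phiD !add0r.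
  by apply/eqP; exact: tensor_neq0.
have yex : exists y : Y, y != 0 by exists y0.
have gex : exists g : dual Y, g != 0 by exists g0.
have [[U0 [W0 [U0D W0D UW0]]]|[W0 [U0 [W0D U0D UW0]]]] :=
  elementary_preserver ttX ttY bigX bigX' phiD inj elem onto.
- left.
  have bal c e f : rank1 (U0 (c *: e)) (W0 f) = rank1 (U0 e) (W0 (c *: f)).
    by rewrite -!UW0 rank1Z.
  have [||b [U [W [lU lW nU nW UW]]]] :=
    normalize_factors U0D W0D bal (fun e f => rkn _ _ _ _ (UW0 e f)).
  + by case: bigX.
  + by case: bigX'.
  have UWonto y g : exists e f, rank1 y g = rank1 (U e) (W f).
    by have [e [f ef]] := onto y g; exists e, f; rewrite UW -UW0.
  have [sU sW] := factors_surjective lU lW UWonto yex gex.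
  have [|||||||||||V [lV nV sV VE]] := @reconstruction R X Y X (dual X) (fun e f => f e)
    (fun e f => rank1 e f) (fun T e => T e) phi b U W
    _ _ _ _ _ _ _ _ _ _ phiD semi _ lU lW nU nW sU sW.
  + by [].
  + by move=> c e f; exact: dual_scale.
  + by move=> e f; rewrite mulrC; exact: dual_le.
  + move=> e M M0 eM; have [f f1 fe] := norming_functional e.
    have := eM f; rewrite fe cabs_pos ?rnorm_ge0// => /le_trans; apply.
    by rewrite ler_piMr.
  + move=> f f0; apply: contrapT => nf; move/eqP: f0; apply; apply: bop_ext => e.
    by apply/eqP; apply: contrapT => /negP fe; apply: nf; exists e.
  + by [].
  + by [].
  + by move=> T; exact: bop_zero.
  + by move=> T iT e; exact: invertible_surj.
  + by move=> T e f iT; exact: rank1_bad_direct.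
  + by move=> e f; rewrite UW0 UW.
  exists U, V; split=> //.
  + exact: semilinear_bijective_isometry lU nU sU.
  + exact: semilinear_bijective_isometry lV nV sV.
  + by apply/semilinear_cases; exists b.
right.
have bal c e f : rank1 (U0 (c *: e)) (W0 f) = rank1 (U0 e) (W0 (c *: f)).
  by rewrite -!UW0 rank1Z.
have [||b [U [W [lU lW nU nW UW]]]] :=
  normalize_factors U0D W0D bal (fun e f => etrans (rkn _ _ _ _ (UW0 f e)) (mulrC _ _)).
+ by case: bigX'.
+ by case: bigX.
have UWonto y g : exists e f, rank1 y g = rank1 (U e) (W f).
  by have [e [f ef]] := onto y g; exists f, e; rewrite UW -UW0.
have [sU sW] := factors_surjective lU lW UWonto yex gex.
have [|||||||||||V [lV nV sV VE]] := @reconstruction R X Y (dual X) X (fun f e => f e)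
  (fun f e => rank1 e f) (fun T f => adjoint T f) phi b U W
  _ _ _ _ _ _ _ _ _ _ phiD semi _ lU lW nU nW sU sW.
+ by move=> c f e; exact: dual_scale.
+ by [].
+ by move=> f e; exact: dual_le.
+ move=> f M M0 fM; apply: opnorm_lub => e e1.
  by apply: le_trans (fM e) _; rewrite ler_piMr.
+ move=> e e0; have [f fe] := functional_one e0; exists f.
  by rewrite fe oner_eq0.
+ by move=> f; apply: bop_ext.
+ by move=> S T f; apply: bop_ext => e; rewrite bopBE !adjointE bopBE bop_sub.
+ by move=> T; exact: bop_zero.
+ by move=> T iT f; exact: invertible_adjoint_surj.
+ by move=> T f e iT; exact: rank1_bad_adjoint.
+ by move=> f e; rewrite UW0 UW.
exists U, V; split=> //.
+ exact: semilinear_bijective_isometry lU nU sU.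
+ exact: semilinear_bijective_isometry lV nV sV.
+ by apply/semilinear_cases; exists b.
Qed.

End Forward.

(** * The standard forms preserve the reduced minimum modulus *)

Lemma gamma_conjugate (R : realType) (A B Y Z : normedModType R[i])
  (U : B -> Z) (V : Y -> A) (S : bop Y Z) (T : bop A B) :
  (forall x, rnorm (U x) = rnorm x) ->
  (forall x y, rnorm (V x - V y) = rnorm (x - y)) -> (forall x, exists y, V y = x) ->
  (forall y, S y = U (T (V y))) -> red_min_modulus S = red_min_modulus T.
Proof.
move=> nU nV sV SE.
have nS y : rnorm (S y) = rnorm (T (V y)) by rewrite SE nU.
have kerE y : S y = 0 <-> T (V y) = 0.
  by split=> e; apply: rnorm_eq0; [rewrite -nS|rewrite nS]; rewrite e rnorm0.
have S0 : (S == 0) = (T == 0).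
  apply/eqP/eqP => e; apply: bop_ext => x.
    by have [y <-] := sV x; apply/kerE; rewrite e.
  by apply/kerE; rewrite e.
have distE y : dist_to (kernel S) y = dist_to (kernel T) (V y).
  congr inf; apply/seteqP; split=> _ [w kw <-].
    by exists (V w); [exact/kerE|exact: nV].
  have [w' w'E] := sV w; exists w'; last by rewrite -nV w'E.
  by apply/kerE; rewrite w'E.
rewrite /red_min_modulus S0; case: ifP => // _; congr ereal_inf.
apply/seteqP; split=> _ [y /= y1 <-].
  by exists (V y); rewrite /= -?distE// nS.
have [z zE] := sV y; exists z; rewrite /= ?distE ?zE//.
by rewrite nS zE.
Qed.

Section AdjointGamma.
Context (R : realType) (X Y : normedModType R[i]).

(** If [T^* f] has norm [M], then [f (T z)] is at most [M] times the distance
    of [z] to the kernel, hence at most [M / c] times the norm of [T z]. A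
    Hahn-Banach extension of [f] from the range then differs from [f] by an
    element of the kernel of [T^*]. *)
Lemma gamma_adjoint_ge (T : bop X Y) :
  (red_min_modulus T <= red_min_modulus (adjoint T))%E.
Proof.
suff bound (c : R) : 0 < c -> (c%:E <= red_min_modulus T)%E ->
    (c%:E <= red_min_modulus (adjoint T))%E.
  have [T0|T0] := eqVneq T 0.
    have -> : adjoint T = 0.
      by apply: bop_ext => f; apply: bop_ext => z; rewrite adjointE T0 bop_zero.
    by rewrite T0 /red_min_modulus !eqxx.
  have : (0%:E <= red_min_modulus T)%E by apply: gamma_ge => z _; exact: rnorm_ge0.
  case TE : (red_min_modulus T) => [c| |] //.
    rewrite lee_fin le_eqVlt => /orP[/eqP <-|c0].
      by apply: gamma_ge => z _; exact: rnorm_ge0.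
    by apply: bound => //; rewrite TE.
  by move=> _; rewrite (gamma_pinfty TE) eqxx in T0.
move=> c0 cT; apply: gamma_ge => f f1; set M := rnorm (adjoint T f).
have M0 : 0 <= M by exact: rnorm_ge0.
have fT z : cabs (f (T z)) <= M / c * rnorm (T z).
  have fTk k : kernel T k -> cabs (f (T z)) <= M * rnorm (z - k).
    move=> Tk; have := dual_le (adjoint T f) (z - k).
    by rewrite adjointE bop_sub Tk subr0.
  have h : cabs (f (T z)) <= M * dist_to (kernel T) z.
    have [M00|Mn0] := eqVneq M 0.
      by have := fTk 0 (kernel0 T); rewrite M00 !mul0r.
    have Mp : 0 < M by rewrite lt_neqAle eq_sym Mn0.
    rewrite mulrC -ler_pdivrMr//; apply: (dist_ge (kernel0 T)) => k Tk.
    by rewrite ler_pdivrMr// mulrC; exact: fTk.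
  apply: le_trans h _; rewrite -mulrA ler_wpM2l// mulrC ler_pdivlMr// mulrC.
  exact: gamma_bound (ltW c0) cT.
have [|||h [hM hT]] := @hahn_banach R Y (fun v a => exists z, v = T z /\ a = f (T z))
    (M / c) (divr_ge0 M0 (ltW c0)).
- by move=> _ _ _ _ [z [-> ->]] [w [-> ->]]; exists (z + w); rewrite bop_add bop_add.
- by move=> a _ _ [z [-> ->]]; exists (a *: z); rewrite bop_scale dual_scale.
- by move=> _ _ [z [-> ->]]; exact: fT.
have fh : kernel (adjoint T) (f - h).
  apply: bop_ext => z; rewrite adjointE bopBE (hT (T z) (f (T z))) ?subrr//.
  by exists z.
have := dist_le f fh; rewrite opprB addrC subrK => /(le_trans f1)/le_trans/(_ hM).
by rewrite ler_pdivlMr// mul1r.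
Qed.

End AdjointGamma.

Section Reflexive.
Context (R : realType) (X : normedModType R[i]).

Lemma rnorm_bidual_embed (x : X) : rnorm (bidual_embed x) = rnorm x.
Proof.
apply/eqP; rewrite eq_le; apply/andP; split.
  apply: opnorm_lub => f f1; rewrite bidual_embedE; apply: le_trans (dual_le _ _) _.
  by rewrite ler_piMl ?rnorm_ge0.
have [f f1 fx] := norming_functional x.
have := opnorm_ub (bidual_embed x) f1; rewrite bidual_embedE fx.
by rewrite -/(cabs _) cabs_pos ?rnorm_ge0.
Qed.

(** Reflexivity identifies [T] with its second adjoint, so the inequality
    between [T] and [T^*] also holds in the other direction. *)
Lemma gamma_adjoint (T : bop X X) : reflexive_space X ->
  red_min_modulus (adjoint T) = red_min_modulus T.
Proof.
move=> rX; apply/eqP; rewrite eq_le gamma_adjoint_ge andbT.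
apply: le_trans (gamma_adjoint_ge (adjoint T)) _.
have [U UP] : exists U : dual (dual X) -> X, forall F, bidual_embed (U F) = F.
  by exists (fun F => projT1 (cid (rX F))) => F; case: cid.
have embedB x y : bidual_embed x - bidual_embed y = bidual_embed (x - y).
  by apply: bop_ext => f; rewrite bopBE !bidual_embedE bop_sub.
suff -> : red_min_modulus T = red_min_modulus (adjoint (adjoint T)) by [].
apply: (gamma_conjugate (U := U) (V := @bidual_embed R X)).
- by move=> F; rewrite -rnorm_bidual_embed UP.
- by move=> x y; rewrite embedB rnorm_bidual_embed.
- exact: rX.
move=> x; apply/eqP; rewrite -subr_eq0; apply/eqP/rnorm_eq0.
rewrite -rnorm_bidual_embed -embedB UP.
suff -> : adjoint (adjoint T) (bidual_embed x) = bidual_embed (T x) by rewrite subrr rnorm0.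
exact: bop_ext.
Qed.

End Reflexive.

Section IsometryTools.
Context (R : realType) (E F : normedModType R[i]) (b : bool) (U : E -> F).
Hypotheses (lU : semilinear b U) (iU : bijective_isometry U).

Lemma bijective_isometry_norm x : rnorm (U x) = rnorm x.
Proof.
have [_ nU] := iU; have := nU x 0; rewrite (semilinear0 lU) !subr0.
by rewrite -!rnormE => /complexI.
Qed.

Lemma bijective_isometry_normB x y : rnorm (U x - U y) = rnorm (x - y).
Proof. by rewrite -(semilinearB _ _ lU) bijective_isometry_norm. Qed.

Lemma bijective_isometry_surj y : exists x, U x = y.
Proof. by have [[g _ gK] _] := iU; exists (g y). Qed.

Lemma bijective_isometry_inverse : exists U' : F -> E,
  [/\ cancel U U', cancel U' U, semilinear b U' & forall y, rnorm (U' y) = rnorm y].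
Proof.
have [[g Ug gU] _] := iU; exists g; split=> // [|y].
  split=> [x y|c x]; apply: (can_inj Ug); rewrite gU.
    by rewrite (proj1 lU) !gU.
  by rewrite (proj2 lU) twistK gU.
by rewrite -bijective_isometry_norm gU.
Qed.

End IsometryTools.

Section Converse.
Context (R : realType) (X Y : completeNormedModType R[i]).
Context (phi : bop X X -> bop Y Y).

Lemma direct_form_gamma : direct_form phi ->
  forall T, red_min_modulus (phi T) = red_min_modulus T.
Proof.
move=> [U [V [iU iV /semilinear_cases[b [lU lV]] phiE]]] T.
apply: (gamma_conjugate (U := U) (V := V)).
- exact: bijective_isometry_norm lU iU.
- exact: bijective_isometry_normB lV iV.
- exact: bijective_isometry_surj iV.
exact: phiE.
Qed.

Hypothesis phi_surj : forall S, exists T, phi T = S.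

(** By surjectivity every operator on the dual of [X] is an adjoint. Applied
    to rank one operators [g |-> F g *: f0] this exhibits [F] as the
    evaluation at a vector. *)
Lemma adjoint_form_reflexive_source : (exists x : X, x != 0) -> adjoint_form phi ->
  reflexive_space X.
Proof.
move=> [x0 x00] [U [V [iU iV /semilinear_cases[b [lU lV]] phiE]]] F.
have [f0 f0x] := functional_one x00.
have nU := bijective_isometry_norm lU iU; have nV := bijective_isometry_norm lV iV.
have bl : is_bounded_linear (fun y => U (F (V y) *: f0)).
  split=> [a y z|].
    rewrite (proj1 lV) (proj2 lV) bop_add dual_scale scalerDl (proj1 lU) -scalerA.
    by rewrite (proj2 lU) twistK.
  exists (rnorm F * rnorm f0) => y; rewrite nU rnZ mulrAC ler_wpM2r ?rnorm_ge0//.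
  by rewrite -nV; exact: dual_le.
have [T TE] := phi_surj (mkbop bl); exists (T x0); apply: bop_ext => g.
have [y <-] := bijective_isometry_surj iV g; rewrite bidual_embedE.
have : U (adjoint T (V y)) = U (F (V y) *: f0) by rewrite -phiE TE.
have [[U' UK _] _] := iU; move=> /(can_inj UK)/(congr1 (fun f : dual X => f x0)).
by rewrite adjointE bopZE f0x /GRing.scale /= mulr1.
Qed.

(** Reflexivity passes from [X] to its dual and then through [U] to [Y]; in
    one step, a functional [Phi] on the dual of [Y] is evaluation at [U f],
    where [f x] is, up to conjugation, the value of [Phi] at the functional that
    [x] induces on [Y] through the inverse of [U]. *)
Lemma reflexive_of_dual_isometry b (U : dual X -> Y) : semilinear b U -> bijective_isometry U ->
  reflexive_space X -> reflexive_space Y.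
Proof.
move=> lU iU rX Phi.
have [U' [UK U'K lU' nU']] := bijective_isometry_inverse lU iU.
have nU := bijective_isometry_norm lU iU.
have twistD c d : twist b (c + d) = twist b c + twist b d :> R[i].
  by case: (b) => //=; exact: rmorphD.
have blg x : is_bounded_linear (fun y => twist b (U' y x) : R[i]^o).
  split=> [a y z|].
    by rewrite (proj1 lU') (proj2 lU') bopDE bopZE twistD twistM twistK.
  exists (rnorm x) => y; rewrite -/(cabs _) cabs_twist mulrC -nU'.
  exact: dual_le.
pose g x : dual Y := mkbop (blg x).
have gE x y : g x y = twist b (U' y x) by [].
have gD x z : g (x + z) = g x + g z.
  by apply: bop_ext => y; rewrite bopDE !gE bop_add twistD.
have gZ a x : g (a *: x) = twist b a *: g x.
  by apply: bop_ext => y; rewrite bopZE !gE dual_scale twistM.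
have blf : is_bounded_linear (fun x => twist b (Phi (g x)) : R[i]^o).
  split=> [a x z|].
    by rewrite gD gZ bop_add dual_scale twistD twistM twistK.
  exists (rnorm Phi) => x; rewrite -/(cabs _) cabs_twist.
  apply: le_trans (dual_le _ _) _; rewrite ler_wpM2l ?rnorm_ge0//.
  apply: opnorm_lub => y y1; rewrite -/(cabs _) gE cabs_twist.
  by apply: le_trans (dual_le _ _) _; rewrite nU' ler_piMl ?rnorm_ge0.
pose f : dual X := mkbop blf.
exists (U f); apply: bop_ext => h; rewrite bidual_embedE.
have blG : is_bounded_linear (fun f' : dual X => twist b (h (U f')) : R[i]^o).
  split=> [a y z|].
    by rewrite (proj1 lU) (proj2 lU) bop_add dual_scale twistD twistM twistK.
  exists (rnorm h) => y; rewrite -/(cabs _) cabs_twist -nU.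
  exact: dual_le.
have [x xE] := rX (mkbop blG).
have xE' (f' : dual X) : f' x = twist b (h (U f')) by rewrite -bidual_embedE xE.
have hg : h = g x by apply: bop_ext => y; rewrite gE xE' twistK U'K.
have fx : f x = twist b (Phi (g x)) by [].
have := xE' f; rewrite fx => /(congr1 (twist b)); rewrite !twistK => <-.
by rewrite hg.
Qed.

Lemma adjoint_form_gamma : (exists x : X, x != 0) -> adjoint_form phi ->
  forall T, red_min_modulus (phi T) = red_min_modulus T.
Proof.
move=> X0 aphi T; rewrite -(gamma_adjoint T (adjoint_form_reflexive_source X0 aphi)).
have [U [V [iU iV /semilinear_cases[b [lU lV]] phiE]]] := aphi.
apply: (gamma_conjugate (U := U) (V := V)).
- exact: bijective_isometry_norm lU iU.
- exact: bijective_isometry_normB lV iV.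
- exact: bijective_isometry_surj iV.
exact: phiE.
Qed.

End Converse.

Local Close Scope complex_scope.

Theorem theorem2p3 (R : realType) (X Y : completeNormedModType R[i])
    (hX : infinite_dimensional X) (hY : infinite_dimensional Y)
    (phi : bop X X -> bop Y Y)
    (phi_add : {morph phi : S T / S + T})
    (phi_surj : forall S : bop Y Y, exists T : bop X X, phi T = S) :
  ((forall T : bop X X, red_min_modulus (phi T) = red_min_modulus T) <->
   direct_form phi \/ adjoint_form phi) /\
  (~ reflexive_space X \/ ~ reflexive_space Y -> ~ adjoint_form phi).
Proof.
have [X0 _] := infinite_dimensional_not_a_line hX.
split.
  split=> [phi_gamma|[dphi|aphi]].
  - exact: preserver_standard_form.
  - exact: direct_form_gamma.
  - exact: adjoint_form_gamma.
move=> nrefl aphi; have rX := adjoint_form_reflexive_source phi_surj X0 aphi.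
have [U [V [iU _ /semilinear_cases[b [lU _]] _]]] := aphi.
by case: nrefl; apply => //; exact: reflexive_of_dual_isometry lU iU rX.
Qed.
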